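(* Let $\mathcal{D}=\mathcal{P}_{\mathcal{D}}\cup\mathcal{L}_{\mathcal{D}}$ be a minimal primal dominating set of the incidence graph of $\mathrm{PG}(2,q)$, $q=p^h>16$, $p$ prime. Let $c_2=c_3=2^{-1/3}$ and $c_p=1$ for $p>3$. Then one of the following holds: (i) $|\mathcal{D}|=2q$, and $\mathcal{D}$ is the union of $q$ collinear points on a line $\ell$ and $q$ concurrent lines through a point $P$ with $P\in\ell$, $P,\ell\notin\mathcal{D}$; (ii) $|\mathcal{D}|=2q+2$, and $\mathcal{D}$ is the union of all points of a line $\ell$ and all lines through a point $P\notin\ell$; (iii) $|\mathcal{D}|=2q+\sqrt{q}+1$, and either there is a Baer subplane $\Pi'$ and a point $P\in\Pi'$ with $\mathcal{L}_{\mathcal{D}}=[P]$ and $\mathcal{P}_{\mathcal{D}}$ the point set of $\Pi'$ minus $P$, or $\mathcal{D}$ is the dual of such a structure; (iv) $3q-1>|\mathcal{D}|>2q+\sqrt{q}+1$, and $\mathcal{D}$ is stable, and either $\mathcal{L}_{\mathcal{D}}$ is a full pencil and $\mathcal{P}_{\mathcal{D}}$ consists of all but possibly one point of a nontrivial minimal blocking set, or $\mathcal{D}$ is the dual of such a structure (the situation where $\mathcal{L}_{\mathcal{D}}$ is a full pencil plus a further line, or its dual, does not occur); moreover either $|\mathcal{D}|=2q+\sqrt{q}+2$, which happens if and only if there is a Baer subplane $\Pi'$ and a point $P\notin\Pi'$ with $\mathcal{L}_{\mathcal{D}}=[P]$ and $\mathcal{P}_{\mathcal{D}}$ the point set of $\Pi'$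 (or $\mathcal{D}$ is the dual structure), or $|\mathcal{D}|\geq 2q+c_pq^{2/3}+1$; (v) $|\mathcal{D}|\geq 3q-1$. In particular, if $|\mathcal{D}|<3q-1$, then $\mathcal{D}$ is stable.
   Context: $\mathrm{PG}(2,q)$ is the Desarguesian projective plane of order $q$. A dominating set $\mathcal{D}=\mathcal{P}_{\mathcal{D}}\cup\mathcal{L}_{\mathcal{D}}$ of its incidence graph is a set of points and lines such that every point not in $\mathcal{P}_{\mathcal{D}}$ lies on a line of $\mathcal{L}_{\mathcal{D}}$ and every line not in $\mathcal{L}_{\mathcal{D}}$ contains a point of $\mathcal{P}_{\mathcal{D}}$; minimal means no proper subset is dominating. $\mathcal{D}$ is stable if it is minimal and there is no dominating set $\mathcal{D}'\supset\mathcal{D}$ with $|\mathcal{D}'|=|\mathcal{D}|+1$ containing a dominating set of size less than $|\mathcal{D}|$. $\mathcal{D}$ is primal if it contains $q$ concurrent lines or $q$ collinear points. $[P]$ denotes the set of all lines through $P$ (a full pencil). A blocking set is a point set meeting every line; nontrivial if it contains no full line; minimal if no proper subset is a blocking set. A Baer subplane is a subplane of order $\sqrt{q}$ ($q$ a square). The dual of a structure interchanges points and lines. *)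

(* Defs.v *)
From HB Require Import structures.
From mathcomp Require Import all_boot all_algebra.
From Stdlib Require Reals.

Set Implicit Arguments.
Unset Strict Implicit.
Unset Printing Implicit Defensive.

(* The Desarguesian plane PG(2,q) = PG(2,F), #|F| = q:
   points = 1-dimensional subspaces of F^3, lines = 2-dimensional subspaces,
   each represented canonically by its row-space matrix <<m>>. *)
Section PG.
Variable F : finFieldType.

Definition is_pt (m : 'M[F]_3) := (\rank m == 1%N) && (<<m>>%MS == m).
Definition is_ln (m : 'M[F]_3) := (\rank m == 2%N) && (<<m>>%MS == m).

Definition point := {m : 'M[F]_3 | is_pt m}.
Definition line := {m : 'M[F]_3 | is_ln m}.

Definition inc (P : point) (L : line) : bool := (val P <= val L)%MS.

Definition pencil (P : point) : {set line} := [set L | inc P L].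
Definition ptsof (L : line) : {set point} := [set P | inc P L].

Definition dominating (Pd : {set point}) (Ld : {set line}) : Prop :=
  (forall P, P \notin Pd -> exists2 L, L \in Ld & inc P L) /\
  (forall L, L \notin Ld -> exists2 P, P \in Pd & inc P L).

Definition dsize (Pd : {set point}) (Ld : {set line}) : nat := #|Pd| + #|Ld|.

Definition minimal_dom (Pd : {set point}) (Ld : {set line}) : Prop :=
  dominating Pd Ld /\
  forall (Pd' : {set point}) (Ld' : {set line}), Pd' \subset Pd -> Ld' \subset Ld -> dominating Pd' Ld' ->
    Pd' = Pd /\ Ld' = Ld.

Definition stable_dom (Pd : {set point}) (Ld : {set line}) : Prop :=
  minimal_dom Pd Ld /\
  ~ (exists (Pd1 Pd2 : {set point}) (Ld1 Ld2 : {set line}),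
      [/\ Pd \subset Pd1, Ld \subset Ld1, dominating Pd1 Ld1,
          dsize Pd1 Ld1 = (dsize Pd Ld).+1 &
          [/\ Pd2 \subset Pd1, Ld2 \subset Ld1, dominating Pd2 Ld2 &
              dsize Pd2 Ld2 < dsize Pd Ld]]).

Definition primal (Pd : {set point}) (Ld : {set line}) : Prop :=
  (exists P, #|F| <= #|Ld :&: pencil P|) \/
  (exists L, #|F| <= #|Pd :&: ptsof L|).

Definition blocking (B : {set point}) : Prop :=
  forall L, exists2 P, P \in B & inc P L.
Definition nontrivial_blocking (B : {set point}) : Prop :=
  blocking B /\ ~ (exists L, ptsof L \subset B).
Definition minimal_blocking (B : {set point}) : Prop :=
  blocking B /\ forall B' : {set point}, B' \proper B -> ~ blocking B'.

Definition dblocking (B : {set line}) : Prop :=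
  forall P, exists2 L, L \in B & inc P L.
Definition nontrivial_dblocking (B : {set line}) : Prop :=
  dblocking B /\ ~ (exists P, pencil P \subset B).
Definition minimal_dblocking (B : {set line}) : Prop :=
  dblocking B /\ forall B' : {set line}, B' \proper B -> ~ dblocking B'.

Definition collinear3 (P Q R : point) : bool :=
  [exists L, [&& inc P L, inc Q L & inc R L]].

Definition subplane_of_order (S : {set point}) (T : {set line}) (n : nat) : Prop :=
  [/\ forall P Q, P \in S -> Q \in S -> P != Q ->
        exists2 L, L \in T & inc P L && inc Q L,
      forall L M, L \in T -> M \in T -> L != M ->
        exists2 P, P \in S & inc P L && inc P M,
      (exists P1 P2 P3 P4,
        [/\ [&& P1 \in S, P2 \in S, P3 \in S & P4 \in S],
            ~~ collinear3 P1 P2 P3, ~~ collinear3 P1 P2 P4,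
            ~~ collinear3 P1 P3 P4 & ~~ collinear3 P2 P3 P4]) &
      forall L, L \in T -> #|S :&: ptsof L| = n.+1].

Definition baer_subplane (S : {set point}) (T : {set line}) : Prop :=
  exists n, n * n = #|F| /\ subplane_of_order S T n.

End PG.

Module Num_conds.
Import Reals.
Local Open Scope R_scope.

Definition c_p (p : nat) : R :=
  if (p == 2%nat) || (p == 3%nat) then Rpower 2 (- (1 / 3)) else 1.

Definition size_is_2q_sqrt_plus (q s k : nat) : Prop :=
  INR s = 2 * INR q + sqrt (INR q) + INR k.

Definition size_gt_2q_sqrt_1 (q s : nat) : Prop :=
  2 * INR q + sqrt (INR q) + 1 < INR s.

Definition size_ge_2q_cp (p q s : nat) : Prop :=
  2 * INR q + c_p p * Rpower (INR q) (2 / 3) + 1 <= INR s.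

End Num_conds.
Export Num_conds.

(* Main.v *)
Require Import Defs.
From HB Require Import structures.
From mathcomp Require Import all_boot all_algebra finfield zify ring.
From Stdlib Require Reals Lra.

(* The heart of the matter is that a minimal nontrivial blocking set B of size
   q + 1 + k with k < c_p q^(2/3) is a Baer subplane.  Fix P in B, a tangent l at
   P, and affine coordinates in which l is the line at infinity and a point R
   lies on the line with label a(R) through P.  Since B meets all lines, the
   Redei polynomial of B forces f = prod (X + a(R)) to have the lacunary form
   X^q g + h with deg h <= deg g = k.  After division by gcd(g, h) and extraction
   of p-th roots, f is divisible by A^Q with A = X^r G + H, Q = p^e, r = q / Q and
   G'H - GH' <> 0.  All roots of A lie in GF(q), so A divides
   E (G'H - GH') as soon as E vanishes at these roots.  Comparing degrees for
   E = X G^Q + H^Q, and for the polynomial E expressing that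
   a |-> -H(a)/G(a) = a^r, twisted by Frobenius and iterated twice, is
   a |-> a^(q/Q^2), shows that q <= Q^2.  Hence through each P in B the lines with
   more than Q points cover all but k - Q of the other points of B, and the sum
   over all lines of (n - 1)(n - Q - 1), n being the number of points of B on the
   line, leaves only q = Q^2, k = Q and n in {1, Q + 1}.

   The same lacunary form yields the bound |S| + |U| >= 2q for a point set S
   missing exactly the lines of a nonempty set U; this bound reduces primal
   dominating sets with fewer than 3q - 1 elements to blocking sets and proves
   their stability. *)

Set Implicit Arguments.
Unset Strict Implicit.
Unset Printing Implicit Defensive.
Import GRing.Theory.

(** * Lacunary polynomials *)

Local Open Scope ring_scope.

(** A tangent serves as line at infinity because only [P] is lost: the [q + k] remaining points of
    [B] are affine and meet every line off [P], as the lacunary form requires. Write [d = deg G].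
    Since [r] is zero in GF(q), [G' A - A' G] is the Wronskian [G'H - GH'], so every nonzero [E]
    vanishing at the roots of [A] has degree above [r - d]. The first [E] settles [Q^3 <= q]; for
    larger [Q] its bound on [d] is too weak, and the second [E] replaces [X] by [X^T] with
    [T = q / Q^2], which acts as a constant under derivation only while [T > 1]. This is why the
    method stops exactly at [q <= Q^2]. In the second range the estimate turns on [p T <= Q]: a
    factor [p >= 5] leaves enough room, whereas for [p = 2, 3] the missing room is bought by
    [2 k^3 < q^2]; this is the origin of [c_2] and [c_3]. All geometry is done for an abstract
    incidence relation with coordinates at each flag. PG(2,q) and its dual both qualify, so a set
    with [q] collinear points is handled by exchanging the roles of points and lines. *)

Section Redei.
Variable F : finFieldType.
Implicit Type s : seq (F * F).

(** The inner variable is [Y]. A pair [(a, b)] is an affine point, and [x + (a y + b) = 0] says that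
    it lies on the line with parameters [x], [y]. *)
Definition redei s : {poly {poly F}} :=
  \prod_(ab <- s) ('X + (ab.1 *: 'X + ab.2%:P)%:P).

Lemma size_coef_redei s i : (size (((redei s)`_i)%R : {poly F}) <= (size s).+1 - i)%N.
Proof.
rewrite /redei; elim: s i => [|[a b] s IHs] i.
  by rewrite big_nil coef1; case: i => [|i] /=; rewrite ?size_poly1 ?size_poly0.
rewrite big_cons mulrDl coefD coefXM coefCM /=.
apply: (leq_trans (size_polyD _ _)); rewrite geq_max; apply/andP; split.
  by case: i => [|i] /=; rewrite ?size_poly0 // (leq_trans (IHs i)).
set c := _ + _; have sz_c : (size c <= 2)%N.
  apply: leq_trans (size_polyD _ _) _; rewrite geq_max.
  rewrite (leq_trans (size_scale_leq _ _)) ?size_polyX //.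
  by rewrite (leq_trans (size_polyC_leq1 _)).
case: (leqP (size s).+1 i) => [le_si | lt_is].
  have /eqP-> : (\prod_(ab <- s) ('X + (ab.1 *: 'X + ab.2%:P)%:P))`_i == 0 :> {poly F}.
    by rewrite -size_poly_leq0 (leq_trans (IHs i)) // leqn0 subn_eq0.
  by rewrite mulr0 size_poly0.
apply: leq_trans (size_polyMleq _ _) _.
have := leq_add sz_c (IHs i); set m := size _; set n := size _; lia.
Qed.

(** The part of top total degree of the Redei polynomial is the product of the [X + a Y], whose
    coefficients are those of the product of the [X + a]. *)
Lemma lead_coef_redei s i : (i <= size s)%N ->
  (redei s)`_i`_(size s - i)%N = (\prod_(ab <- s) ('X + ab.1%:P))`_i.
Proof.
rewrite /redei; elim: s i => [|[a b] s IHs] i /=.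
  by rewrite leqn0 => /eqP->; rewrite !big_nil !coef1.
move=> le_i; rewrite !big_cons !mulrDl !coefD !coefXM !coefCM /=.
set R := \prod_(_ <- _) _ in IHs *; congr (_ + _).
  case: i le_i => [|i] le_i /=; first by rewrite coef0.
  by rewrite subSS IHs.
have sz : (size ((R`_i)%R : {poly F}) <= (size s).+1 - i)%N by apply: size_coef_redei.
rewrite mulrDl coefD -scalerAl coefZ coefXM coefCM.
case: (leqP i (size s)) => [le_is | lt_si].
  rewrite subSn //= IHs // (nth_default _ (s := R`_i)) ?mulr0 ?addr0 //.
  by rewrite (leq_trans sz) // subSn.
have -> : R`_i = 0 by apply/eqP; rewrite -size_poly_leq0 (leq_trans sz) // leqn0 subn_eq0.
rewrite !coef0 /= if_same !mulr0 addr0 nth_default ?mulr0 //.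
apply: leq_trans lt_si; rewrite -[X in (_ <= X)%N]/((size s).+1).
elim: (s) => [|ab t IHt]; first by rewrite big_nil size_poly1.
rewrite big_cons; apply: leq_trans (size_polyMleq _ _) _.
by rewrite size_XaddC.
Qed.

Lemma horner_redei s y :
  map_poly (fun c : {poly F} => c.[y]) (redei s) =
  \prod_(ab <- s) ('X + (ab.1 * y + ab.2)%:P).
Proof.
rewrite -[LHS]/(map_poly (horner_eval y) _) rmorph_prod /=; apply: eq_bigr => ab _.
by rewrite rmorphD /= map_polyX map_polyC /= /horner_eval hornerD hornerZ hornerX hornerC.
Qed.

(* For each value of [Y] the Redei polynomial is a multiple of [X^q - X].  Hence
   its coefficient of [X^i] is constant on [F]; having degree less than [q] in
   [Y], it is a constant polynomial, so its leading part vanishes. *)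
Lemma redei_lacunary s k :
    size s = (#|F| + k)%N -> (k.+1 < #|F|)%N ->
    (forall x y, has (fun ab => x + (ab.1 * y + ab.2) == 0) s) ->
  forall i, (k < i < #|F|)%N -> (\prod_(ab <- s) ('X + ab.1%:P))`_i = 0.
Proof.
move=> sz_s lt_kq blk i /andP[lt_ki lt_iq].
have le_is : (i <= size s)%N by lia.
rewrite -lead_coef_redei //; set sg := (redei s)`_i.
have sz_sg : (size sg <= (size s).+1 - i)%N by apply: size_coef_redei.
(* For [k < i < q], the product of [X^q - X] with a monic [g] of degree [k] has at [X^i] the
   negative of the coefficient of [X^(i-1)] in [g]: this is [-1] for [i = k + 1] and [0] beyond. *)
suff : sg + ((i == k.+1)%:R)%:P = 0.
  move/(congr1 (fun p : {poly F} => p`_(size s - i))).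
  by rewrite coefD coefC subn_eq0 [(_ <= i)%N]leqNgt
    (leq_trans lt_iq) ?sz_s ?leq_addr //= coef0 addr0.
apply/eqP; apply: contraT => nz.
have le_q : (size (sg + ((i == k.+1)%:R)%:P)%R <= #|F|)%N.
  apply: leq_trans (size_polyD _ _) _; rewrite geq_max; apply/andP; split; first by lia.
  by rewrite (leq_trans (size_polyC_leq1 _)) //; lia.
have: (size (enum F) < size (sg + ((i == k.+1)%:R)%:P)%R)%N.
  apply: max_poly_roots nz _ (enum_uniq _); apply/allP=> y _.
  rewrite rootE hornerD hornerC.
  pose Fy := \prod_(ab <- s) ('X + (ab.1 * y + ab.2)%:P).
  have -> : sg.[y] = Fy`_i.
    by rewrite /Fy -horner_redei (coef_map (horner_eval y)).
  have FyE : Fy = \prod_(ab <- s) ('X - (- (ab.1 * y + ab.2))%:P).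
    by apply: eq_bigr => ab _; rewrite polyCN opprK.
  have mon : Fy \is monic by rewrite FyE monic_prod_XsubC.
  have szF : size Fy = (#|F| + k).+1 by rewrite FyE size_prod_XsubC sz_s.
  have : 'X^#|F| - 'X %| Fy.
    rewrite finField_genPoly -big_enum /=; apply: uniq_roots_dvdp; last first.
      by rewrite uniq_rootsE enum_uniq.
    apply/allP=> x _; have /hasP[ab ab_s /eqP ab0] := blk x y.
    rewrite rootE /Fy (big_rem ab ab_s) /= hornerM hornerD hornerX hornerC ab0.
    by rewrite mul0r.
  case/dvdpP => g FyM.
  have szX : size ('X^#|F| - 'X : {poly F}) = #|F|.+1.
    by rewrite size_polyDl size_polyXn // size_polyN size_polyX; lia.
  have monX : 'X^#|F| - 'X \is @monic F.
    by rewrite finField_genPoly monic_prod_XsubC.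
  have mong : g \is monic by move: mon; rewrite FyM monicMr.
  have szg : size g = k.+1.
    have := size_mul (monic_neq0 mong) (monic_neq0 monX).
    by rewrite -FyM szX szF addnS /= addnC => /eqP; rewrite -addSn eqn_add2r => /eqP.
  rewrite FyM mulrBr coefB coefMXn coefMX lt_iq sub0r.
  case: i {sg sz_sg le_q le_is} lt_ki lt_iq => // i lt_ki lt_iq /=.
  rewrite eqSS; have [->|ne] := eqVneq i k.
    by move/monicP: mong; rewrite lead_coefE szg => /= ->; rewrite addrC subrr.
  by rewrite nth_default ?oppr0 ?addr0 // szg; lia.
by rewrite -cardE => lt; rewrite leqNgt lt in le_q.
Qed.
End Redei.

(** * Powers of Frobenius as ring morphisms *)

Section FrobeniusPower.
Variables (R : comNzRingType) (p : nat).
Hypothesis charRp : p \in [pchar R].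

(** The proof of [p \in [pchar R]] is an argument so that the ring morphism structures declared
    below can be inferred from the term. *)
Definition frob (_ : p \in [pchar R]) m (x : R) := x ^+ (p ^ m).

Lemma pnat_pchar_expn m : [pchar R].-nat (p ^ m)%N.
Proof.
rewrite (eq_pnat _ (pcharf_eq charRp)) pnatX pnat_id ?orbT //.
exact: pcharf_prime charRp.
Qed.

Lemma exprD_frob m (x y : R) : (x + y) ^+ (p ^ m) = x ^+ (p ^ m) + y ^+ (p ^ m).
Proof. exact: exprDn_pchar (pnat_pchar_expn m). Qed.

Fact frob_is_nmod_morphism m : nmod_morphism (frob charRp m).
Proof.
split; last by move=> x y; rewrite /frob exprD_frob.
by rewrite /frob expr0n expn_eq0 eqn0Ngt prime_gt0 // (pcharf_prime charRp).
Qed.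

Fact frob_is_monoid_morphism m : monoid_morphism (frob charRp m).
Proof. by split=> [|x y]; rewrite /frob ?expr1n ?exprMn. Qed.

HB.instance Definition _ m :=
  GRing.isNmodMorphism.Build R R (frob charRp m) (frob_is_nmod_morphism m).
HB.instance Definition _ m :=
  GRing.isMonoidMorphism.Build R R (frob charRp m) (frob_is_monoid_morphism m).

Lemma natr_expn_pchar m : (0 < m)%N -> ((p ^ m)%N)%:R = 0 :> R.
Proof. by case: m => // m _; rewrite expnS natrM (pcharf0 charRp) mul0r. Qed.

End FrobeniusPower.

Section HornerFrob.
Variables (F : fieldType) (p : nat).
Hypothesis charFp : p \in [pchar F].

Lemma exprX_horner m (P : {poly F}) a :
  P.[a] ^+ (p ^ m) = (map_poly (frob charFp m) P).[a ^+ (p ^ m)].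
Proof. by rewrite -[LHS]/(frob charFp m P.[a]) -horner_map. Qed.

End HornerFrob.

(** The derivative is a sum of products, each omitting one factor [X - a], and [E] supplies the
    omitted factor. Repeated roots are allowed. *)
Lemma dvdp_deriv_prod_XsubC (F : fieldType) (rs : seq F) (E : {poly F}) :
    all (root E) rs ->
  \prod_(a <- rs) ('X - a%:P) %| E * (\prod_(a <- rs) ('X - a%:P))^`().
Proof.
elim: rs => [|a rs IHrs] /=; first by rewrite big_nil dvd1p.
case/andP=> rEa /IHrs; rewrite big_cons derivM derivXsubC mul1r mulrDr => IH.
apply: dvdp_add; first by rewrite dvdp_mul // dvdp_XsubCl.
by rewrite mulrCA dvdp_mul.
Qed.

(** * Wronskian of a split lacunary polynomial *)

Section Wronskian.
Variables (F : fieldType) (r : nat) (G H : {poly F}) (rs : seq F).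
Hypothesis r0 : r%:R = 0 :> F.
Let A := 'X^r * G + H.
Hypothesis splitA : A %= \prod_(a <- rs) ('X - a%:P).

(** As [r] is zero in [F], [A' = X^r G' + H']; hence [E G' A - E A' G] eliminates [X^r], and [A]
    divides both terms. *)
Lemma dvdp_wronskian E :
  (forall a, root A a -> root E a) -> A %| E * (G^`() * H - G * H^`()).
Proof.
move=> rE; case/eqpP: splitA => [[c1 c2] /= /andP[nz_c1 nz_c2] eA0].
have [c nz_c eA] : exists2 c, c != 0 & A = c *: \prod_(a <- rs) ('X - a%:P).
  exists (c1^-1 * c2); first by rewrite mulf_neq0 ?invr_eq0.
  by rewrite -scalerA -eA0 scalerA mulVf // scale1r.
have A'E : A^`() = 'X^r * G^`() + H^`().
  by rewrite derivD derivM derivXn -scaler_nat r0 scale0r mul0r add0r.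
have dA' : A %| E * A^`().
  rewrite eA derivZ dvdpZl // -scalerAr dvdpZr //; apply: dvdp_deriv_prod_XsubC.
  apply/allP=> a rs_a; apply: rE.
  by rewrite eA rootZ // root_prod_XsubC.
have -> : E * (G^`() * H - G * H^`()) = (E * G^`()) * A - (E * A^`()) * G.
  by rewrite A'E /A; ring.
by apply: dvdp_sub; [exact: dvdp_mulIr | exact: dvdp_mulr].
Qed.
End Wronskian.

Lemma size_wronskian (F : fieldType) (G H : {poly F}) k :
  (size G <= k.+1)%N -> (size H <= k.+1)%N ->
  (size (G^`() * H - G * H^`())%R <= k.*2)%N.
Proof.
move=> szG szH.
have sz' (P : {poly F}) : (size P <= k.+1)%N -> (size (P^`())%R <= k)%N.
  move=> szP; have [->|nzP] := eqVneq P 0; first by rewrite deriv0 size_poly0.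
  by rewrite -ltnS (leq_trans (lt_size_deriv nzP)).
have szM (P R : {poly F}) : (size P <= k.+1)%N -> (size R <= k)%N -> (size (P * R)%R <= k.*2)%N.
  by move=> szP szR; apply: leq_trans (size_polyMleq _ _) _; lia.
apply: leq_trans (size_polyD _ _) _; rewrite size_polyN geq_max.
by rewrite [_ * H]mulrC !szM ?sz'.
Qed.

(** * Substitution of a fraction into a polynomial *)

Section Homogenization.
Variables (F : fieldType) (U V : {poly F}).

(** For [deg P <= K] this is [V^K P(U/V)], the substitution of [U/V] with denominators cleared. *)
Definition homog K (P : {poly F}) : {poly F} :=
  \sum_(i < K.+1) P`_i *: (U ^+ i * V ^+ (K - i)).

Lemma size_homog K (P : {poly F}) k : (0 < k)%N -> (size U <= k.+1)%N -> (size V <= k.+1)%N ->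
  (size (homog K P) <= (K * k).+1)%N.
Proof.
move=> k_gt0 szU szV; apply: leq_trans (size_sum _ _ _) _.
apply/bigmax_leqP=> i _; apply: leq_trans (size_scale_leq _ _) _.
apply: leq_trans (size_polyMleq _ _) _.
have szX (R : {poly F}) m : (size R <= k.+1)%N -> (size (R ^+ m)%R <= (k * m).+1)%N.
  move=> szR; apply: leq_trans (size_poly_exp_leq _ _) _; rewrite ltnS leq_mul2r.
  by apply/orP; right; lia.
have := szX U i szU; have := szX V (K - i)%N szV; have := ltn_ord i; nia.
Qed.

Lemma deriv_monomial i m :
  V * (U ^+ i * V ^+ m)^`() =
  V^`() * (U ^+ i * V ^+ m) *+ (i + m)
    + (U^`() * V - U * V^`()) * (U ^+ i.-1 * V ^+ m) *+ i.
Proof.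
have XpredM (W : {poly F}) n : W ^+ n.-1 * W *+ n = W ^+ n *+ n.
  by case: n => // n; rewrite -exprSr.
have := XpredM U i; have := XpredM V m; rewrite derivM !deriv_exp mulrnDr.
move: (U ^+ i.-1) (V ^+ m.-1) (U ^+ i) (V ^+ m) => x y u v e1 e2.
transitivity (V^`() * u * (y * V *+ m) + x * V * U^`() * v *+ i); first by ring.
rewrite e1; transitivity (V^`() * u * (v *+ m) + V^`() * v * (u *+ i)
    + (U^`() * V * x * v *+ i - V^`() * v * (x * U *+ i))).
  by rewrite e2; ring.
by ring.
Qed.

(** Quotient rule for [V^(K+1) P(U/V)]: the derivative of [U/V] is [(U'V - UV') / V^2], and the
    factor [V] on the left clears the last denominator. *)
Lemma deriv_homog K P :
  V * (homog K.+1 P)^`() =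
  V^`() * homog K.+1 P *+ K.+1 + (U^`() * V - U * V^`()) * homog K P^`().
Proof.
rewrite /homog; set J := _ - _.
transitivity (\sum_(i < K.+2) (V^`() * (P`_i *: (U ^+ i * V ^+ (K.+1 - i))) *+ K.+1
    + J * (P`_i *+ i *: (U ^+ i.-1 * V ^+ (K.+1 - i))))).
  rewrite raddf_sum /= mulr_sumr; apply: eq_bigr => i _.
  rewrite derivZ -scalerAr deriv_monomial subnKC -1?ltnS // scalerDr -/J.
  by rewrite -!mul_polyC polyCMn; ring.
rewrite big_split /= sumrMnl -!mulr_sumr; congr (_ + J * _).
rewrite big_ord_recl mulr0n scale0r add0r; apply: eq_bigr => i _.
by rewrite coef_deriv subSS.
Qed.

Let ev (P : {poly F}) :=
  (map_poly (@tofrac {poly F} \o polyC) P).[tofrac U / tofrac V].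

Lemma tofrac_homog K (P : {poly F}) : V != 0 -> (size P <= K.+1)%N ->
  tofrac (homog K P) = tofrac V ^+ K * ev P.
Proof.
move=> nzV szP; rewrite /ev (horner_coef_wide _ (n := K.+1)); last first.
  by rewrite (leq_trans (size_poly _ _)).
rewrite /homog rmorph_sum /= mulr_sumr; apply: eq_bigr => i _.
rewrite coef_map -mul_polyC !rmorphM /= !rmorphXn /= expr_div_n.
have nz : tofrac V != 0 by rewrite tofrac_eq0.
have le_iK : (i <= K)%N by rewrite -ltnS.
have -> : tofrac V ^+ K = tofrac V ^+ (K - i) * tofrac V ^+ i by rewrite -exprD subnK.
by rewrite [RHS]mulrC -!mulrA [_^-1 * _]mulrCA mulVf ?expf_neq0 // mulr1.
Qed.

Lemma homogM K L (P R : {poly F}) : V != 0 -> (size P <= K.+1)%N -> (size R <= L.+1)%N ->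
  homog K P * homog L R = homog (K + L) (P * R).
Proof.
move=> nzV szP szR; apply/eqP; rewrite -tofrac_eq rmorphM /=; apply/eqP.
have szPR : (size (P * R)%R <= (K + L).+1)%N.
  by apply: leq_trans (size_polyMleq _ _) _; lia.
rewrite (tofrac_homog nzV szP) (tofrac_homog nzV szR) (tofrac_homog nzV szPR).
by rewrite /ev rmorphM hornerM exprD mulrACA.
Qed.

Lemma homogB K P R : homog K (P - R) = homog K P - homog K R.
Proof.
by rewrite /homog -sumrB; apply: eq_bigr => i _; rewrite coefB scalerBl.
Qed.

(** After lowering [K] to [d = deg P], the term in [U^d] is the only one free of [V], so a vanishing
    sum would make [V] divide [U^d]. *)
Lemma homog_eq0 K (P : {poly F}) : coprimep U V -> (1 < size V)%N ->
  (size P <= K.+1)%N -> homog K P = 0 -> P = 0.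
Proof.
move=> cUV szV szP P0; apply/eqP; apply: contraT => nzP.
have nzV : V != 0 by rewrite -size_poly_gt0 (leq_trans _ szV).
have : homog (size P).-1 P = 0.
  apply/eqP; rewrite -tofrac_eq0 (tofrac_homog nzV (leqSpred _)).
  have /eqP := congr1 (@tofrac _) P0; rewrite (tofrac_homog nzV szP) rmorph0.
  rewrite mulf_eq0 expf_eq0 tofrac_eq0 (negPf nzV) andbF => /eqP ->.
  by rewrite mulr0 eqxx.
rewrite /homog big_ord_recr /= subnn expr0 mulr1 => /eqP.
rewrite addrC addr_eq0 => /eqP Ulast.
have : V %| U ^+ (size P).-1.
  rewrite -(dvdpZr _ _ (c := lead_coef P)) ?lead_coef_eq0 // lead_coefE Ulast.
  rewrite dvdpNr; apply: (big_ind (fun x => V %| x)) => [|x y|]; [exact: dvdp0 | exact: dvdp_add |].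
  move=> i _; rewrite -mul_polyC dvdp_mull // dvdp_mull // dvdp_exp //.
  by rewrite subn_gt0.
have cVU : coprimep V (U ^+ (size P).-1) by rewrite coprimep_expr // coprimep_sym.
by move/coprimep_dvdl/(_ cVU); rewrite coprimepp => /eqP szV1; rewrite szV1 in szV.
Qed.
End Homogenization.

(** * Two degree bounds for a lacunary factor *)

Section LacunaryFactor.
Variables (F : finFieldType) (p n : nat).
Hypotheses (pr_p : prime p) (cardF : #|F| = (p ^ n)%N).
Variables (e : nat) (G H : {poly F}) (rs : seq F).
Hypothesis lt_en : (e < n)%N.
Let r := (p ^ (n - e))%N.
Let A := 'X^r * G + H.
Hypothesis cGH : coprimep G H.
Hypothesis le_HG : (size H <= size G)%N.
Hypothesis splitA : A %= \prod_(a <- rs) ('X - a%:P).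
Let W := G^`() * H - G * H^`().
Hypothesis nzW : W != 0.
Let k := (size G).-1.

Let charFp : p \in [pchar F] := card_finPcharP cardF pr_p.
Let r0 : r%:R = 0 :> F.
Proof. by apply: natr_expn_pchar charFp _ _; rewrite subn_gt0. Qed.

Let r_gt0 : (0 < r)%N. Proof. by rewrite expn_gt0 prime_gt0. Qed.

Lemma lacunary_deg_gt0 : (0 < k)%N.
Proof.
rewrite lt0n; apply: contraNneq nzW => k0.
have sz1 : (size G <= 1)%N by move: k0; rewrite /k; case: (size G) => [|[]].
rewrite /W (size1_polyC sz1) (size1_polyC (leq_trans le_HG sz1)).
by rewrite !derivC mul0r mulr0 subr0.
Qed.

Let szG : size G = k.+1.
Proof. by rewrite prednK // ltnNge leqn0; apply: contraTneq lacunary_deg_gt0; rewrite /k => ->. Qed.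

Let szH : (size H <= k.+1)%N. Proof. by rewrite -szG. Qed.

Lemma size_lacunary : size A = (r + k).+1.
Proof.
have nzG : G != 0 by rewrite -size_poly_eq0 szG.
have szXG : size ('X^r * G) = (r + k).+1.
  by rewrite mulrC size_mulXn // szG addnS addnC.
by rewrite /A size_polyDl szXG // ltnS (leq_trans szH) // -add1n leq_add2r.
Qed.

(** [A] divides the nonzero polynomial [E W], where [deg A = r + k] and [deg W < 2 k]. *)
Let le_sizeA (E : {poly F}) m : E != 0 -> (size E <= m.+1)%N ->
  (forall a, root A a -> root E a) -> (r < m + k)%N.
Proof.
move=> nzE szE rE; have := dvdp_wronskian r0 splitA rE; rewrite -/W.
move/(dvdp_leq (mulf_neq0 nzE nzW)); rewrite size_mul // -/A size_lacunary.
have szG' : (size G <= k.+1)%N by rewrite szG.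
have := size_wronskian szG' szH; rewrite -/W.
by clearbody k r; move: (size W) (size E) szE => w m'; lia.
Qed.

(** Raising [A(a) = 0] to the power [Q] turns [a^r] into [a^q = a]. The term [X G^Q] dominates
    [H^Q], so [E] is nonzero of degree [k Q + 1]. *)
Lemma lacunary_bound1 : (p ^ (n - e) <= k * (p ^ e).+1)%N.
Proof.
set Q := (p ^ e)%N; pose E := 'X * G ^+ Q + H ^+ Q.
have szX (R : {poly F}) : (size R <= k.+1)%N -> (size (R ^+ Q)%R <= (k * Q).+1)%N.
  move=> szR; apply: leq_trans (size_poly_exp_leq _ _) _.
  by rewrite ltnS leq_mul2r; apply/orP; right; lia.
have nzG : G != 0 by rewrite -size_poly_eq0 szG.
have szXG : size ('X * G ^+ Q) = (k * Q).+2.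
  rewrite mulrC size_mulX ?expf_neq0 //.
  by rewrite -[size _]prednK ?size_poly_gt0 ?expf_neq0 // size_exp.
have szE : size E = (k * Q).+2.
  by rewrite /E size_polyDl szXG // ltnS szX.
have nzE : E != 0 by rewrite -size_poly_eq0 szE.
have := le_sizeA (m := (k * Q).+1) nzE; rewrite szE leqnn => /(_ isT).
rewrite -/r mulnS; suff rE a : root A a -> root E a by move/(_ rE); lia.
rewrite !rootE /A /E !hornerE => /eqP Aa0.
have : (a ^+ r * G.[a] + H.[a]) ^+ Q = 0 by rewrite Aa0 expr0n expn_eq0 eqn0Ngt prime_gt0.
rewrite (exprD_frob charFp) exprMn -exprM -expnD subnK ?(ltnW lt_en) // -cardF.
by rewrite expf_card => ->.
Qed.

(** At a root [a] of [A], [-H(a) = a^r G(a)], so [D] and [N] take the values [G(a)^k G(a)^r] and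
    [G(a)^k H(a)^r], also when [G(a) = 0]. As [r^2 = q T], [a^T = a^(r^2)], whence
    [E(a) = G(a)^k A(a)^r = 0]. *)
Lemma lacunary_bound2 : (2 * e < n)%N ->
  (p ^ (n - e) < p ^ (n - 2 * e) + k ^ 2 + k)%N.
Proof.
move=> lt_2en; set T := (p ^ (n - 2 * e))%N; pose m := (n - e)%N.
pose Gs := map_poly (frob charFp m) G; pose Hs := map_poly (frob charFp m) H.
pose D := homog (- H) G k Gs; pose N := homog (- H) G k Hs.
pose E := 'X^T * D + N.
have szGs : (size Gs <= k.+1)%N by rewrite size_map_poly szG.
have szHs : (size Hs <= k.+1)%N by rewrite size_map_poly.
have k_gt0 := lacunary_deg_gt0.
have nzG : G != 0 by rewrite -size_poly_eq0 szG.
have szE : (size E <= (T + k ^ 2).+1)%N.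
  have szh P : (size (homog (- H) G k P) <= (k ^ 2).+1)%N.
    by rewrite -mulnn size_homog // ?size_polyN ?szG.
  apply: leq_trans (size_polyD _ _) _; rewrite geq_max (leq_trans (szh _)) ?ltnS ?leq_addl ?andbT //.
  apply: leq_trans (size_polyMleq _ _) _; rewrite size_polyXn /=.
  by rewrite -addnS leq_add2l szh.
have T0 : T%:R = 0 :> F.
  by apply: natr_expn_pchar charFp _ _; rewrite subn_gt0.
(* If [N = - X^T D], the Wronskian of [N] and [D] vanishes because [T] is zero in [F]. By
   [deriv_homog] its product with [G] is [W] times the homogenized Wronskian of [Hs] and [Gs], so
   the latter vanishes; Frobenius being injective, [W] would vanish too. *)
have nzE : E != 0.
  apply: contraTneq nzW => E0; rewrite negbK.
  have eN : N = - ('X^T * D) by apply/eqP; rewrite -addr_eq0 addrC -/E E0.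
  have eN' : N^`() = - ('X^T * D^`()).
    rewrite eN derivN derivM derivXn -mulr_natl -polyC1 -polyCMn T0.
    by rewrite polyC0 !mul0r add0r.
  have := deriv_homog (- H) G k.-1 Gs; have := deriv_homog (- H) G k.-1 Hs.
  rewrite prednK // -/N -/D derivN; set J := _ - _ => eVN eVD.
  have JE : J = W by rewrite /J /W; ring.
  have : J * (homog (- H) G k.-1 Hs^`() * D - N * homog (- H) G k.-1 Gs^`()) = 0.
    transitivity (G * (N^`() * D - N * D^`())); last by rewrite eN' eN; ring.
    transitivity ((G * N^`()) * D - N * (G * D^`())); last by ring.
    by rewrite eVN eVD; ring.
  move/eqP; rewrite mulf_eq0 JE => /orP[// |].
  have sz' (P : {poly F}) : (size P <= k.+1)%N -> (size (P^`())%R <= k.-1.+1)%N.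
    move=> szP; rewrite prednK //; have [->|nzP] := eqVneq P 0.
      by rewrite deriv0 size_poly0.
    by rewrite -ltnS (leq_trans (lt_size_deriv nzP)).
  rewrite /N /D !homogM ?sz' // [(k + k.-1)%N]addnC -homogB => /eqP/homog_eq0 w0.
  have : Hs^`() * Gs - Hs * Gs^`() = 0.
    apply: w0; first by rewrite -scaleN1r coprimepZl ?oppr_eq0 ?oner_eq0 // coprimep_sym.
      by rewrite szG.
    by apply: leq_trans (size_wronskian szHs szGs) _; lia.
  rewrite /Gs /Hs !deriv_map -!rmorphM -rmorphB => /eqP.
  rewrite map_poly_eq0 => /eqP w'0; rewrite -oppr_eq0 opprB -w'0 mulrC.
  by rewrite [_ * H]mulrC.
suff rE a : root A a -> root E a.
  by have := le_sizeA nzE szE rE; rewrite -/r /T; lia.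
rewrite !rootE => /eqP Aa0.
have HE : (- H).[a] = a ^+ r * G.[a].
  by rewrite hornerN; apply/eqP; rewrite eq_sym -addr_eq0 -Aa0 /A !hornerE.
have homE (P : {poly F}) : (size P <= k.+1)%N ->
    (homog (- H) G k (map_poly (frob charFp m) P)).[a] = G.[a] ^+ k * P.[a] ^+ r.
  move=> szP; rewrite [P.[a] ^+ r](exprX_horner charFp) -/m -/r.
  rewrite [X in _ * X](horner_coef_wide _ (n := k.+1)) ?size_map_poly // mulr_sumr.
  rewrite /homog horner_sum; apply: eq_bigr => i _.
  rewrite hornerZ hornerM !horner_exp HE exprMn.
  have -> : G.[a] ^+ k = G.[a] ^+ i * G.[a] ^+ (k - i) by rewrite -exprD subnKC // -ltnS.
  by ring.
rewrite /E hornerD hornerM hornerXn !homE ?szG //.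
have -> : a ^+ T = a ^+ r ^+ r.
  rewrite -exprM -[a in LHS]expf_card -exprM cardF -!expnD; congr (_ ^+ (p ^ _)); lia.
rewrite mulrCA -mulrDr -exprMn -(exprD_frob charFp).
have -> : a ^+ r * G.[a] + H.[a] = 0 by rewrite -HE hornerN addNr.
by rewrite expr0n expn_eq0 eqn0Ngt prime_gt0 //= mulr0.
Qed.

End LacunaryFactor.

(** Integer form of [k < c_p q^(2/3)]: cubing removes the roots, and the cube of [c_p] is [1/2] for
    [p <= 3]. *)
Definition below_two_thirds (p q k : nat) : bool :=
  (k ^ 3 < q ^ 2)%N && ((p <= 3) ==> (2 * k ^ 3 < q ^ 2))%N.

(** From [q <= k Q (Q + 1)] and [(Q + 1)^3 <= q] follows [q^2 <= (k Q)^3]. For [n = 3 e] the second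
    inequality fails, but then [Q <= k] and [k Q >= Q^2 = q^(2/3)] directly. *)
Lemma small_exponent_contra p n e k :
    prime p -> (16 < p ^ n)%N -> (3 * e <= n)%N ->
    (p ^ (n - e) <= k * (p ^ e).+1)%N ->
  ~~ below_two_thirds p (p ^ n) (k * p ^ e).
Proof.
move=> pr_p gt16 le_3en le_k; apply/negP=> /andP[lt_k _].
have p_gt1 := prime_gt1 pr_p.
have eq_n : (p ^ n = p ^ (n - e) * p ^ e)%N by rewrite -expnD subnK //; lia.
set Q := (p ^ e)%N in le_k lt_k eq_n; set q := (p ^ n)%N in gt16 lt_k eq_n.
have Q_gt0 : (0 < Q)%N by rewrite expn_gt0; lia.
have le_q : (q <= k * Q * Q.+1)%N by rewrite eq_n; nia.
move: le_3en; rewrite leq_eqVlt => /orP[/eqP eq_3en | lt_3en].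
  have qE : q = (Q ^ 3)%N by rewrite /q /Q -expnM; congr (_ ^ _)%N; lia.
  have le_Qk : (Q <= k)%N.
    rewrite leqNgt; apply/negP=> lt_kQ; move: le_q; rewrite qE; nia.
  have : (Q * Q <= k * Q)%N by rewrite leq_mul2r le_Qk orbT.
  rewrite -(@leq_exp2r _ _ 3) // leqNgt => /negP; apply.
  by apply: leq_trans lt_k _; rewrite qE; lia.
have le_pQ : (p * Q ^ 3 <= q)%N.
  by rewrite /q /Q -expnM -expnS leq_exp2l //; lia.
have le_cube : (q ^ 3 <= (k * Q) ^ 3 * Q.+1 ^ 3)%N by rewrite -expnMn leq_exp2r.
case: (posnP e) => [e0 | e_gt0].
  move: le_q; rewrite /Q e0 expn0 muln1 => le_q.
  have := leq_exp2r q (k * 2) (isT : 0 < 3)%N; rewrite le_q.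
  by move: lt_k; rewrite /Q e0 expn0 muln1 expnMn; nia.
(* For [Q >= 4], [(Q + 1)^3 <= 2 Q^3 <= p Q^3]. Otherwise [e = 1] and [Q = p] is [2] or [3], where
   [q >= 32] and [q >= 81] respectively. *)
have le_qQ : (Q.+1 ^ 3 <= q)%N.
  have [le4Q | lt_Q4] := leqP 4 Q; first by apply: leq_trans le_pQ; nia.
  have le_pQ1 : (p <= Q)%N by rewrite /Q -{1}[p]expn1 leq_exp2l.
  have e1 : e = 1%N.
    apply/eqP; rewrite eqn_leq e_gt0 andbT leqNgt; apply/negP=> e_gt1.
    by have : (p ^ 2 <= Q)%N; [rewrite leq_exp2l | nia].
  have [p2 | p3] : p = 2%N \/ p = 3%N by lia.
    have lt4n : (4 < n)%N by move: gt16; rewrite /q p2 -[16%N]/(2 ^ 4)%N ltn_exp2l.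
    by rewrite /Q e1 /q p2; apply: (@leq_trans (2 ^ 5)%N); rewrite ?leq_exp2l.
  by rewrite /Q e1 /q p3; apply: (@leq_trans (3 ^ 4)%N); rewrite ?leq_exp2l //; lia.
have : (q ^ 3 <= (k * Q) ^ 3 * q)%N by apply: leq_trans le_cube _; rewrite leq_mul2l le_qQ orbT.
by nia.
Qed.

(* Write [Q = p^e], [T = p^(n - 2e)], so that [q = T Q^2] and [p T <= Q]; the
   size bound gives [5 k^2 < 3 T Q]. *)
Lemma mid_exponent_contra p n e k :
    prime p -> (n < 3 * e)%N -> (2 * e < n)%N ->
    (p ^ (n - e) < p ^ (n - 2 * e) + k ^ 2 + k)%N ->
  ~~ below_two_thirds p (p ^ n) (k * p ^ e).
Proof.
(* [27/125] is the cube of [3/5]. These are used with [X = k^6], [Y = (T Q)^3], [Z = (T^2 Q)^2],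
   where [p T <= Q] means [p Z <= Y]. For [p <= 3] the factor [4] is the square of that in [2 k^3];
   for [p >= 5] the bound [X < Y/5] suffices as [125/5 < 27]. *)
have num1 X Y Z : (2 * Z <= Y -> 4 * X < Z -> ~~ (27 * Y <= 125 * X))%N by lia.
have num2 X Y Z : (5 * Z <= Y -> X < Z -> ~~ (27 * Y <= 125 * X))%N by lia.
(* Here [M] is [T Q]. For [x >= 4], [x <= x^2 / 4] gives the absurd [M < M/4 + 5 x^2 / 4 < M]; the
   smaller [x] are checked one by one. *)
have num3 t x M : (M < t + x ^ 2 + x -> 5 * x ^ 2 < 3 * M -> 4 * t <= M -> ~~ (8 <= M))%N.
  move=> lt1 lt2 le4; apply/negP=> le8; have : (x < 4)%N.
    by rewrite ltnNge; apply/negP=> le4x; have : (4 * x <= x ^ 2)%N; [nia | lia].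
  by case: x lt1 lt2 => [|[|[|[|]]]] //; lia.
move=> pr_p lt_n3e lt_2en; have p_gt1 := prime_gt1 pr_p.
set T := (p ^ (n - 2 * e))%N; set Q := (p ^ e)%N.
have -> : (p ^ (n - e) = T * Q)%N by rewrite /T /Q -expnD; congr (_ ^ _)%N; lia.
have -> : (p ^ n = T * (Q * Q))%N by rewrite /T /Q -!expnD; congr (_ ^ _)%N; lia.
have le_pT : (p * T <= Q)%N by rewrite /T /Q -expnS leq_exp2l //; lia.
have T_gt1 : (1 < T)%N.
  have : (p ^ 1 <= T)%N by rewrite leq_exp2l //; lia.
  by rewrite expn1; apply: leq_trans.
move: (T) (Q) le_pT T_gt1 => {lt_n3e lt_2en}T' Q' le_pT T_gt1 lt_TQ.
apply/negP=> /andP[lt_k /implyP lt_k2].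
have Q_gt0 : (0 < Q')%N by nia.
have lt1 : (k ^ 3 < T' ^ 2 * Q')%N.
  have : (k ^ 3 * Q' ^ 3 < (T' ^ 2 * Q') * Q' ^ 3)%N by move: lt_k; rewrite !expnMn; lia.
  by rewrite ltn_pmul2r // expn_gt0 Q_gt0.
have lt2 : (p <= 3)%N -> (2 * k ^ 3 < T' ^ 2 * Q')%N.
  move/lt_k2 => lt'.
  have : ((2 * k ^ 3) * Q' ^ 3 < (T' ^ 2 * Q') * Q' ^ 3)%N by move: lt'; rewrite !expnMn; lia.
  by rewrite ltn_pmul2r // expn_gt0 Q_gt0.
have sq x y : (x < y -> x ^ 2 < y ^ 2)%N by rewrite ltn_exp2r.
have lt5 : (5 * k ^ 2 < 3 * (T' * Q'))%N.
  rewrite ltnNge -(leq_exp2r _ _ (isT : 0 < 3)%N) (expnMn 3) (expnMn T') (expnMn 5) -expnM.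
  have eT : ((T' ^ 2 * Q') ^ 2 = T' ^ 3 * Q' ^ 2 * T')%N by ring.
  have eY : (T' ^ 3 * Q' ^ 3 = T' ^ 3 * Q' ^ 2 * Q')%N by ring.
  rewrite eY; have [le_p3 | lt_3p] := leqP p 3.
    have := sq _ _ (lt2 le_p3); rewrite eT (expnMn 2) -expnM.
    have : (T' ^ 3 * Q' ^ 2 * (2 * T') <= T' ^ 3 * Q' ^ 2 * Q')%N.
      by rewrite leq_mul2l (leq_trans _ le_pT) ?orbT // leq_mul2r p_gt1 orbT.
    rewrite mulnCA -[(2 ^ 2)%N]/4%N -[(3 ^ 3)%N]/27%N -[(5 ^ 3)%N]/125%N.
    by apply: num1.
  have p_gt4 : (4 < p)%N by rewrite ltn_neqAle lt_3p andbT; apply: contraTneq pr_p => <-.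
  have := sq _ _ lt1; rewrite eT -expnM.
  have : (T' ^ 3 * Q' ^ 2 * (5 * T') <= T' ^ 3 * Q' ^ 2 * Q')%N.
    by rewrite leq_mul2l (leq_trans _ le_pT) ?orbT // leq_mul2r p_gt4 orbT.
  by rewrite mulnCA -[(3 ^ 3)%N]/27%N -[(5 ^ 3)%N]/125%N; apply: num2.
have le2T : (2 * T' <= Q')%N by apply: leq_trans le_pT; rewrite leq_mul2r p_gt1 orbT.
have le4 : (4 * T' <= T' * Q')%N.
  by rewrite mulnC leq_mul2l (leq_trans _ le2T) ?orbT // (leq_mul2l 2 2).
have le8 : (8 <= T' * Q')%N by apply: leq_trans le4; rewrite (leq_mul2l 4 2).
by move: le8; apply/negP; apply: num3 lt_TQ lt5 le4.
Qed.

(** * Extraction of p-th roots *)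

Section PthRoot.
Variables (F : finFieldType) (p n : nat).
Hypotheses (pr_p : prime p) (cardF : #|F| = (p ^ n)%N).
Let charFp : p \in [pchar F] := card_finPcharP cardF pr_p.

(** Only exponents divisible by [p] survive, and [c^(p^(n-1))] is a [p]-th root of [c] in a field
    with [p^n] elements. *)
Lemma deriv_eq0_pth_power (g : {poly F}) : g^`() = 0 -> exists G, g = G ^+ p.
Proof.
move=> g'0; have p_gt0 := prime_gt0 pr_p.
have n_gt0 : (0 < n)%N.
  by rewrite lt0n; apply/eqP=> n0; have := finRing_gt1 F; rewrite cardF n0.
have charP : p \in [pchar {poly F}] by rewrite pchar_poly.
exists (\sum_(i < size g) (g`_(i * p) ^+ (p ^ n.-1)) *: 'X^i).
rewrite -[p in RHS]expn1 -[RHS]/(frob charP 1 _) rmorph_sum /=.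
apply/polyP=> j; rewrite coef_sum.
transitivity (\sum_(i < size g) (g`_(i * p) * (j == i * p)%N%:R)); last first.
  apply: eq_bigr => i _; rewrite /frob expn1 exprZn -!exprM -expnSr prednK //.
  by rewrite -cardF expf_card coefZ coefXn.
have [/dvdnP[i ->] | p'j] := boolP (p %| j)%N; last first.
  rewrite big1 => [|i _]; last first.
    by case: eqP => [jE|]; rewrite ?mulr0 //; rewrite jE dvdn_mull in p'j.
  rewrite (dvdn_pcharf charFp) in p'j; apply: mulfI p'j _ _ _.
  by rewrite mulr0 mulr_natl; case: j => // j; rewrite -coef_deriv g'0 coef0.
have [lt_i | le_i] := ltnP i (size g).
  rewrite (bigD1 (Ordinal lt_i)) //= eqxx mulr1 big1 ?addr0 // => k ne_k.
  by rewrite eqn_pmul2r // [i == k]eq_sym (negPf (_ : (k : nat) != i)) ?mulr0 //.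
rewrite nth_default; last by rewrite (leq_trans le_i) // leq_pmulr.
rewrite big1 // => k _; rewrite eqn_pmul2r // gtn_eqF ?mulr0 //.
exact: leq_trans le_i.
Qed.

(** If [G'H = GH'], coprimality makes [G] divide [G'], so both derivatives vanish and [G], [H] and
    [X^(p^j) G + H] are all [p]-th powers: [j] drops by one and [e] grows by one, with [deg G] times
    [p^e] unchanged. The descent ends at a nonzero Wronskian or at [e = n]. *)
Lemma lacunary_descent (f : {poly F}) j e (G H : {poly F}) :
    (j + e = n)%N -> G != 0 -> coprimep G H -> (size H <= size G)%N ->
    ('X^(p ^ j) * G + H) ^+ (p ^ e) %| f ->
  exists e' (G' H' : {poly F}),
    [/\ (e' <= n)%N, G' != 0, coprimep G' H', (size H' <= size G')%N &
     [/\ ('X^(p ^ (n - e')) * G' + H') ^+ (p ^ e') %| f,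
         ((size G').-1 * p ^ e' = (size G).-1 * p ^ e)%N &
         (e' < n)%N -> G'^`() * H' - G' * H'^`() != 0]].
Proof.
have charP : p \in [pchar {poly F}] by rewrite pchar_poly.
elim: j e G H => [|j IHj] e G H; rewrite ?add0n.
  by move=> -> nzG cGH leHG dvf; exists n, G, H; rewrite subnn ltnn; split.
move=> jen nzG cGH leHG dvf.
have [W0|nzW] := eqVneq (G^`() * H - G * H^`()) 0; last first.
  exists e, G, H; split=> //; first by rewrite -jen leq_addl.
  by split=> //; rewrite -jen addnK.
have G'0 : G^`() = 0.
  have : G %| G^`() * H by move/eqP: W0; rewrite subr_eq0 => /eqP->; apply: dvdp_mulIl.
  rewrite Gauss_dvdpl // => dvG; apply/eqP; apply: contraT => nzG'.
  by have := dvdp_leq nzG' dvG; rewrite leqNgt lt_size_deriv.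
have H'0 : H^`() = 0.
  move/eqP: W0; rewrite G'0 mul0r sub0r oppr_eq0 mulf_eq0 (negPf nzG).
  by move/eqP.
have [[G1 eG] [H1 eH]] := (deriv_eq0_pth_power G'0, deriv_eq0_pth_power H'0).
have p_gt0 := prime_gt0 pr_p.
have nzG1 : G1 != 0 by apply: contraNneq nzG => G10; rewrite eG G10 expr0n eqn0Ngt p_gt0.
have szX (P : {poly F}) : size (P ^+ p) = if P == 0 then 0%N else ((size P).-1 * p).+1.
  have [->|nzP] := eqVneq P 0; first by rewrite expr0n eqn0Ngt p_gt0 size_poly0.
  by rewrite -size_exp prednK // size_poly_gt0 expf_neq0.
have := IHj e.+1 G1 H1; rewrite addnS -addSn => /(_ jen nzG1).
have cGH1 : coprimep G1 H1.
  by move: cGH; rewrite eG eH coprimep_pexpl // coprimep_pexpr.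
have leHG1 : (size H1 <= size G1)%N.
  move: leHG; rewrite eG eH !szX (negPf nzG1); case: eqP => [->|/eqP nzH1]; first by rewrite size_poly0.
  by rewrite ltnS leq_pmul2r // -!subn1 leq_sub2rE // size_poly_gt0.
have -> : ('X^(p ^ j) * G1 + H1) ^+ (p ^ e.+1) = ('X^(p ^ j.+1) * G + H) ^+ (p ^ e).
  rewrite expnS exprM; congr (_ ^+ _).
  have := exprD_frob charP 1 ('X^(p ^ j) * G1) H1; rewrite expn1 => ->.
  by rewrite exprMn -exprM -expnSr -eG -eH.
move=> /(_ cGH1 leHG1 dvf) [e' [G' [H' [le_e nz' c' le' [dv' szE nzW']]]]].
exists e', G', H'; split=> //; split=> //.
by rewrite szE eG szX (negPf nzG1) /= expnS mulnA.
Qed.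
End PthRoot.

(** * Heavy roots of a lacunary product *)

Section LacunaryMain.
Variables (F : finFieldType) (p n k : nat) (rs : seq F).
Hypotheses (pr_p : prime p) (cardF : #|F| = (p ^ n)%N).
Hypotheses (gt16 : (16 < #|F|)%N) (small_k : below_two_thirds p #|F| k).
Hypothesis size_rs : size rs = (#|F| + k)%N.
Let f := \prod_(a <- rs) ('X - a%:P).
Hypothesis lacunary_f : forall i, (k < i < #|F|)%N -> f`_i = 0.
Hypothesis count_lt : forall a, (count_mem a rs < #|F|)%N.

Lemma count_mem_prod_XsubC m a (s : seq F) :
  (m <= count_mem a s)%N = (('X - a%:P) ^+ m %| \prod_(b <- s) ('X - b%:P)).
Proof.
rewrite -mup_geq; last by rewrite monic_neq0 ?monic_prod_XsubC.
congr (_ <= _)%N; elim: s => [|b s IHs] /=.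
  by rewrite big_nil mupNroot // rootC oner_eq0.
rewrite big_cons mupM ?polyXsubC_eq0 ?monic_neq0 ?monic_prod_XsubC // -IHs.
by rewrite -[X in mup a X]expr1 mup_XsubCX eq_sym; case: eqP.
Qed.

Lemma lacunary_factor : exists e (A : {poly F}),
  [/\ (n <= 2 * e)%N, (e < n)%N, ((p ^ (n - e)).+1 < size A)%N & A ^+ (p ^ e) %| f].
Proof.
have le_kq : (k < #|F|)%N.
  rewrite ltnNge; apply/negP=> le_qk; case/andP: small_k => + _.
  rewrite ltnNge => /negP; apply; apply: leq_trans (_ : #|F| ^ 3 <= _)%N; last by rewrite leq_exp2r.
  by rewrite leq_exp2l // (leq_trans _ gt16).
set g := drop_poly #|F| f; set h := take_poly #|F| f.
have fE : f = 'X^#|F| * g + h by rewrite mulrC addrC poly_take_drop.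
have szf : size f = (#|F| + k).+1 by rewrite size_prod_XsubC size_rs.
have szg : size g = k.+1 by rewrite size_drop_poly szf -addnS addnC addnK.
have nzg : g != 0 by rewrite -size_poly_eq0 szg.
have szh : (size h <= k.+1)%N.
  apply/leq_sizeP => i le_ki; rewrite coef_take_poly; case: ifP => // lt_iq.
  by apply: lacunary_f; rewrite le_ki.
set d := gcdp g h; pose G := g %/ d; pose H := h %/ d.
have nzd : d != 0 by rewrite gcdp_eq0 negb_and nzg.
have gE : g = G * d by rewrite divpK // dvdp_gcdl.
have hE : h = H * d by rewrite divpK // dvdp_gcdr.
have nzG : G != 0 by apply: contraNneq nzg; rewrite gE => ->; rewrite mul0r.
have cGH : coprimep G H by apply: coprimep_div_gcd; rewrite nzg.
have leHG : (size H <= size G)%N by rewrite !size_divp // leq_sub2r // szg.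
have dvf : ('X^(p ^ n) * G + H) ^+ (p ^ 0) %| f.
  by rewrite expr1 fE gE hE mulrA -mulrDl -cardF dvdp_mulIl.
have szGk : ((size G).-1 <= k)%N by rewrite size_divp // szg; lia.
have [e [G' [H' [le_en nzG' cGH' leHG' [dvf' szG' nzW]]]]] :=
  lacunary_descent pr_p cardF (addn0 n) nzG cGH leHG dvf.
set A := _ + H' in dvf'.
have [m splitA] : {m | A %= \prod_(a <- mask m rs) ('X - a%:P)}.
  by apply: dvdp_prod_XsubC; apply: dvdp_trans dvf'; rewrite dvdp_exp // expn_gt0 prime_gt0.
have le_k : ((size G').-1 * p ^ e <= k)%N by rewrite szG' muln1.
(* For [e = n] the degree bound makes [G'] and [H'] constant, so [A] is linear and [f] has a root of
   multiplicity [q], against [count_lt]. *)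
move: le_en; rewrite leq_eqVlt => /orP[/eqP en | lt_en].
  have k'0 : (size G').-1 = 0%N.
    apply/eqP; rewrite -leqn0 -ltnS -(ltn_pmul2r (m := #|F|)) ?mul1n ?cardF.
      by rewrite -{1}en; apply: leq_ltn_trans le_k _; rewrite -cardF.
    by rewrite expn_gt0 prime_gt0.
  have sz1 : (size G' <= 1)%N by move: k'0; case: (size G') => [|[]].
  have [c cE] : exists c, G' = c%:P by exists G'`_0; apply: size1_polyC.
  have [c' c'E] : exists c, H' = c%:P by exists H'`_0; apply: size1_polyC; apply: leq_trans sz1.
  have nzc : c != 0 by rewrite -polyC_eq0 -cE.
  have AE : A = c *: ('X - (- c' / c)%:P).
    rewrite /A en subnn expn0 cE c'E scalerBr -!mul_polyC -polyCM mulrC.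
    by rewrite mulrCA divff // mulr1 polyCN opprK.
  have := count_lt (- c' / c); rewrite ltnNge => /negP[].
  rewrite count_mem_prod_XsubC cardF -{1}en; apply: dvdp_trans dvf'.
  by rewrite AE exprZn dvdpZr // expf_neq0.
have {}nzW := nzW lt_en.
have small' : below_two_thirds p #|F| ((size G').-1 * p ^ e).
  have le3 : (((size G').-1 * p ^ e) ^ 3 <= k ^ 3)%N by rewrite leq_exp2r.
  case/andP: small_k => lt1 /implyP lt2; apply/andP; split.
    exact: leq_ltn_trans lt1.
  by apply/implyP=> /lt2; apply: leq_ltn_trans; rewrite leq_mul2l le3.
exists e, A; split=> //.
- rewrite leqNgt; apply/negP=> lt_2en; have [le_3en | lt_n3e] := leqP (3 * e) n.
    have := lacunary_bound1 pr_p cardF lt_en cGH' leHG' splitA nzW.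
    move/(small_exponent_contra pr_p); rewrite -cardF => /(_ gt16 le_3en).
    by rewrite small'.
  have := lacunary_bound2 pr_p cardF lt_en cGH' leHG' splitA nzW lt_2en.
  by move/(mid_exponent_contra pr_p lt_n3e lt_2en); rewrite -cardF small'.
- rewrite (size_lacunary n pr_p e leHG' nzW) ltnS -addn1 leq_add2l.
  exact: lacunary_deg_gt0 leHG' nzW.
Qed.

(** [uphalf n] is [n/2] rounded up, so [n <= 2 e] gives [Q <= p^e]. The factor [A^(p^e)] alone has
    degree at least [(p^(n-e) + 1) p^e = q + p^e], and its roots have multiplicity at least [p^e] in
    [f]. *)
Lemma lacunary_heavy_roots : let Q := (p ^ uphalf n)%N in
  (#|F| + Q <= count (fun a => Q <= count_mem a rs) rs)%N.
Proof.
have [e [A [le_n2e lt_en szA dvA]]] := lacunary_factor.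
have p_gt0 := prime_gt0 pr_p; have Qe_gt0 : (0 < p ^ e)%N by rewrite expn_gt0 p_gt0.
set Q := (p ^ uphalf n)%N => /=; have le_Q : (Q <= p ^ e)%N.
  by rewrite leq_pexp2l // leq_uphalf_double -mul2n.
have [m eA] := dvdp_prod_XsubC dvA.
have nzA : A != 0 by rewrite -size_poly_gt0; apply: leq_trans szA.
have szm : (#|F| + p ^ e <= size (mask m rs))%N.
  have := eqp_size eA; rewrite size_prod_XsubC => eqsz.
  have := size_exp A (p ^ e); rewrite eqsz /= => ->.
  have -> : #|F| = (p ^ (n - e) * p ^ e)%N by rewrite cardF -expnD subnK // ltnW.
  rewrite -mulSnr leq_mul2r; apply/orP; right.
  by rewrite -ltnS prednK // size_poly_gt0.
apply: leq_trans (leq_add (leqnn _) le_Q) _; apply: leq_trans szm _.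
apply: leq_trans (leq_count_subseq _ (mask_subseq m rs)).
suff : all (fun a => Q <= count_mem a rs)%N (mask m rs) by rewrite all_count => /eqP->.
apply/allP=> a ma.
apply: leq_trans le_Q _; rewrite count_mem_prod_XsubC; apply: dvdp_trans dvA.
rewrite dvdp_exp2r // dvdp_XsubCl.
have : root (A ^+ (p ^ e)) a by rewrite (eqp_root eA) root_prod_XsubC.
by rewrite !rootE horner_exp expf_eq0 => /andP[].
Qed.
End LacunaryMain.

Local Close Scope ring_scope.

(** * Blocking sets in coordinatized planes *)

Record plane (q : nat) (Pt Ln : finType) (inc : Pt -> Ln -> bool) : Prop := Plane {
  plane_join : forall P R, exists L, inc P L && inc R L;
  plane_meet : forall L M, exists P, inc P L && inc P M;
  plane_uniq : forall P R L M,
    P != R -> inc P L -> inc R L -> inc P M -> inc R M -> L = M;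
  plane_line : forall L, #|[set P | inc P L]| = q.+1;
  plane_pencil : forall P, #|[set L | inc P L]| = q.+1
}.

Lemma plane_dual q Pt Ln inc :
  @plane q Pt Ln inc -> plane q (fun L P => inc P L).
Proof.
case=> jn mt un ln pn; split=> // L M P R neLM LP MP LR MR.
by apply/eqP; apply: contraNT neLM => nePR; apply/eqP; apply: un nePR _ _ _ _.
Qed.

(* Affine coordinates on the complement of [l], for which the lines through the
   point [P] of [l] are the lines on which [a] is constant. *)
Definition coordinatized (F : finFieldType) (Pt Ln : finType)
    (inc : Pt -> Ln -> bool) : Prop :=
  forall P l, inc P l -> exists a b : Pt -> F,
    (forall x y, exists2 L, ~~ inc P L &
       forall R, ~~ inc R l -> inc R L = (x + (a R * y + b R) == 0)%R) /\
    (forall c, exists2 L, inc P L && (L != l) &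
       forall R, ~~ inc R l -> inc R L = (a R == c)).

Section PlaneTheory.
Variables (q : nat) (Pt Ln : finType) (inc : Pt -> Ln -> bool).
Hypothesis pl : plane q inc.
Implicit Types (P R X : Pt) (L M : Ln) (B S : {set Pt}) (T : {set Ln}).

Definition points_on L := [set P | inc P L].
Definition lines_through P := [set L | inc P L].
Definition secant_size B L := #|B :&: points_on L|.
Local Notation pts := points_on.
Local Notation pen := lines_through.
Local Notation secant := secant_size.

Lemma card_join P R (T : pred Ln) : P != R ->
  #|[set L | [&& inc P L, inc R L & T L]]| =
  [exists L, [&& inc P L, inc R L & T L]].
Proof.
move=> nePR; case: existsP => [[L LPR] | noL]; last first.
  by apply: eq_card0 => L; rewrite inE; apply/negP=> PRL; case: noL; exists L.
rewrite -[RHS](cards1 L); congr #|pred_of_set _|; apply/setP=> M; rewrite !inE.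
apply/idP/eqP=> [/and3P[PM RM _] | -> //]; case/and3P: LPR => PL RL _.
exact: (plane_uniq pl nePR).
Qed.

Lemma sum_secant B T :
  \sum_(L in T) secant B L = \sum_(P in B) #|T :&: pen P|.
Proof.
transitivity (\sum_(L in T) \sum_(P in B) (inc P L : nat)).
  apply: eq_bigr => L _; rewrite /secant_size -sum1_card [RHS]big_mkcond /=.
  rewrite [LHS]big_mkcond; apply: eq_bigr => P _; rewrite !inE.
  by case: (P \in B); case: (inc P L).
rewrite exchange_big; apply: eq_bigr => P _.
rewrite -sum1_card [RHS]big_mkcond [LHS]big_mkcond; apply: eq_bigr => L _.
by rewrite !inE; case: (L \in T); case: (inc P L).
Qed.

Lemma sum_secant_pencil B X : X \notin B ->
  \sum_(L in pen X) secant B L = #|B|.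
Proof.
move=> XB; rewrite sum_secant -sum1_card; apply: eq_bigr => P PB.
have neXP : X != P by apply: contraNneq XB => ->.
transitivity #|[set L | [&& inc X L, inc P L & xpredT L]]|.
  by apply: eq_card => L; rewrite !inE andbT.
rewrite card_join //; case: existsP => // -[].
by case: (plane_join pl X P) => L /andP[XL PL]; exists L; rewrite XL PL.
Qed.

Lemma sum_secant_all B : \sum_L secant B L = (#|B| * q.+1)%N.
Proof.
transitivity (\sum_(L in [set: Ln]) secant B L).
  by apply: eq_bigl => L; rewrite inE.
rewrite sum_secant -sum_nat_const; apply: eq_bigr => P _.
by rewrite setTI (plane_pencil pl).
Qed.

(** Double count of ordered pairs of distinct points of [B] on a line of [T]: two points determine
    at most one such line. [T] will select all lines or only the short ones. *)
Lemma sum_secant_pairs B (T : pred Ln) :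
  \sum_(L | T L) secant B L * (secant B L).-1 =
  \sum_(P in B) #|[set R in B :\ P | [exists L, [&& inc P L, inc R L & T L]]]|.
Proof.
transitivity (\sum_(L | T L) \sum_(P in B) \sum_(R in B :\ P) (inc P L && inc R L : nat)).
  apply: eq_bigr => L _; rewrite {1}/secant_size -sum1_card big_distrl /=.
  rewrite big_mkcond [RHS]big_mkcond; apply: eq_bigr => P _; rewrite !inE.
  case PB: (P \in B) => //=; case PL: (inc P L); last by rewrite big1.
  rewrite mul1n /secant_size (cardsD1 P) !inE PB PL /= -sum1_card big_mkcond.
  rewrite [RHS]big_mkcond; apply: eq_bigr => R _; rewrite !inE.
  by case: (R == P); case: (R \in B); case: (inc R L).
rewrite exchange_big; apply: eq_bigr => P PB; rewrite exchange_big /= -sum1_card.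
rewrite [LHS]big_mkcond [RHS]big_mkcond; apply: eq_bigr => R _; rewrite !inE.
have [//|neRP] := eqVneq R P; case: (R \in B) => //=.
rewrite eq_sym in neRP; transitivity #|[set L | [&& inc P L, inc R L & T L]]|.
  rewrite -sum1_card [RHS]big_mkcond [LHS]big_mkcond; apply: eq_bigr => L _.
  by rewrite !inE; case: (T L); case: (inc P L); case: (inc R L).
by rewrite card_join //; case: ifP.
Qed.

End PlaneTheory.

(** * Affine blocking sets and missed lines *)

Section CoordinatizedPlane.
Variables (F : finFieldType) (Pt Ln : finType) (inc : Pt -> Ln -> bool).
Hypothesis pl : plane #|F| inc.
Hypothesis co : coordinatized F inc.
Implicit Types (P R X : Pt) (L M l : Ln) (B S : {set Pt}) (T : {set Ln}).
Local Notation pts := (points_on inc).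
Local Notation pen := (lines_through inc).
Local Notation secant := (secant_size inc).
Local Notation q := #|F|.

Local Open Scope ring_scope.

Lemma affine_gap P l (a b : Pt -> F) S k :
    (forall x y, exists2 L, ~~ inc P L &
       forall R, ~~ inc R l -> inc R L = (x + (a R * y + b R) == 0)) ->
    (forall R, R \in S -> ~~ inc R l) ->
    (forall L, ~~ inc P L -> exists2 R, R \in S & inc R L) ->
    #|S| = (q + k)%N -> (k.+1 < q)%N ->
  forall i, (k < i < q)%N -> (\prod_(R <- enum S) ('X + (a R)%:P))`_i = 0.
Proof.
move=> cab Sl blk cardS lt_kq i ltki.
have := @redei_lacunary F [seq (a R, b R) | R <- enum S] k.
rewrite size_map -cardE => /(_ cardS lt_kq) redS.
suff blk' x y : has (fun ab : F * F => x + (ab.1 * y + ab.2) == 0) [seq (a R, b R) | R <- enum S].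
  by have := redS blk' i ltki; rewrite big_map.
have [L PL LE] := cab x y; have [R SR RL] := blk _ PL.
rewrite has_map; apply/hasP; exists R; first by rewrite mem_enum.
by rewrite /= -LE // Sl.
Qed.

(** This is the bound [2 q - 1] for affine blocking sets. Every label occurs, so [X^q - X] divides
    [f = X^q g + h], hence also [X g + h]; for a smaller [S] the gap makes the degree of the latter
    [k + 1 < q]. *)
Lemma affine_blocking S l :
    (forall R, R \in S -> ~~ inc R l) ->
    (forall L, L != l -> exists2 R, R \in S & inc R L) ->
  (2 * q <= #|S|.+1)%N.
Proof.
move=> Sl blk; have [P Pl] : exists P, inc P l.
  by have [P /andP[Pl _]] := plane_meet pl l l; exists P.
have [a [b [cab ca]]] := co Pl.
have nPl L : ~~ inc P L -> L != l by apply: contraNneq => ->.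
pose f := \prod_(R <- enum S) ('X + (a R)%:P).
have fE : f = \prod_(c <- [seq - a R | R <- enum S]) ('X - c%:P).
  by rewrite big_map; apply: eq_bigr => R _; rewrite polyCN opprK.
have szf : size f = #|S|.+1 by rewrite fE size_prod_XsubC size_map -cardE.
have monf : f \is monic by rewrite fE monic_prod_XsubC.
have dvf : 'X^q - 'X %| f.
  rewrite finField_genPoly -big_enum /=; apply: uniq_roots_dvdp; last first.
    by rewrite uniq_rootsE enum_uniq.
  apply/allP=> c _; have [L /andP[PL neLl] LE] := ca (- c).
  have [R SR RL] := blk L neLl; rewrite fE root_prod_XsubC.
  apply/mapP; exists R; rewrite ?mem_enum //.
  by apply/eqP; rewrite eq_sym eqr_oppLR -LE ?RL ?Sl.
have q_gt1 : (1 < q)%N := finNzRing_gt1 F.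
have szX : size ('X^q - 'X : {poly F}) = q.+1.
  by rewrite size_polyDl size_polyXn // size_polyN size_polyX.
have le_qS : (q <= #|S|)%N.
  by rewrite -ltnS -szf -szX dvdp_leq // monic_neq0.
rewrite leqNgt; apply/negP=> lt_S.
pose k := (#|S| - q)%N; have cardS : #|S| = (q + k)%N by rewrite subnKC.
have lt_kq : (k.+1 < q)%N by lia.
have gap := affine_gap cab Sl (fun L nPL => blk L (nPl L nPL)) cardS lt_kq.
set g := drop_poly q f; set h := take_poly q f.
have feq : f = h + g * 'X^q by rewrite poly_take_drop.
have szg : size g = k.+1 by rewrite size_drop_poly szf cardS -addnS addnC addnK.
have szh : (size h <= k.+1)%N.
  apply/leq_sizeP => i le_ki; rewrite coef_take_poly; case: ifP => // lt_iq.
  by apply: gap; rewrite le_ki.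
have szgh : size (g * 'X + h) = k.+2.
  by rewrite size_polyDl size_mulX -?size_poly_eq0 szg // ltnS.
have : 'X^q - 'X %| g * 'X + h.
  have -> : g * 'X + h = f - g * ('X^q - 'X) by rewrite feq; ring.
  by apply: dvdp_sub; rewrite ?dvdp_mulIr.
by move/dvdp_leq; rewrite -size_poly_eq0 szgh szX => /(_ isT); lia.
Qed.

Local Close Scope ring_scope.

(** Fix a missed line [l] and add to [S], for every other missed line, one of its points off [l]:
    the enlarged set avoids [l] and meets all other lines, so it has at least [2 q - 1] points. *)
Lemma missed_lines_bound S :
  let U := [set L | [disjoint S & pts L]] in U != set0 -> 2 * q <= #|S| + #|U|.
Proof.
move=> U /set0Pn[l Ul]; have q_gt1 : 1 < q := finNzRing_gt1 F.
have off_l L : L \in U :\ l -> exists R, inc R L && ~~ inc R l.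
  case/setD1P=> neLl _; apply/existsP; rewrite -[X in is_true X]negbK negb_exists.
  apply/forallP=> sLl; have : pts L \subset pts l.
    by apply/subsetP=> R; rewrite !inE => RL; have := sLl R; rewrite RL negbK.
  rewrite subEproper => /orP[/eqP|/proper_card]; last first.
    by rewrite !(plane_line pl) ltnn.
  have : 1 < #|pts L| by rewrite (plane_line pl) ltnS ltnW.
  case/card_gt1P=> R [R' [RL R'L neRR']] eLl.
  suff eL : L = l by rewrite eL eqxx in neLl.
  have := RL; have := R'L; rewrite eLl; move: RL R'L; rewrite !inE => RL R'L R'l Rl.
  exact: (plane_uniq pl neRR' RL R'L Rl R'l).
have [g gE] : exists g, forall L, L \in U :\ l -> inc (g L) L && ~~ inc (g L) l.
  apply: (@fin_all_exists _ _ (fun L R => L \in U :\ l -> inc R L && ~~ inc R l)) => L.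
  have [/off_l [R RL] | _] := boolP (L \in U :\ l); first by exists R.
  by have [P _] := plane_meet pl l l; exists P.
have : 2 * q <= #|S :|: [set g L | L in U :\ l]|.+1.
  apply: (@affine_blocking _ l) => [R | L neLl].
    rewrite inE => /orP[SR | /imsetP[L UL ->]]; last by have /andP[] := gE L UL.
    by move: Ul; rewrite inE => /disjoint_setI0/setP/(_ R); rewrite !inE SR /= => ->.
  have [UL | UL] := boolP (L \in U).
    have UlL : L \in U :\ l by rewrite in_setD1 neLl.
    by exists (g L); [rewrite inE imset_f ?orbT | have /andP[] := gE L UlL].
  move: UL; rewrite inE => /pred0Pn[R /andP[SR]]; rewrite /= inE => RL.
  by exists R; [apply/setUP; left | ].
move/leq_trans; apply; rewrite (cardsD1 l U) Ul addnCA ltnS.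
by apply: leq_trans (leq_card_setU _ _) _; rewrite leq_add2l leq_imset_card.
Qed.
End CoordinatizedPlane.

Lemma count_enum (T : finType) (S : {set T}) (a : pred T) :
  count a (enum S) = #|[set x in S | a x]|.
Proof.
rewrite -size_filter cardE; apply/perm_size/uniq_perm; [exact/filter_uniq/enum_uniq | exact: enum_uniq |].
by move=> x; rewrite mem_filter !mem_enum !inE andbC.
Qed.

Lemma below_two_thirds_half p q k : 16 < q -> below_two_thirds p q k -> 2 * k <= q.
Proof.
move=> gt16 /andP[lt_k _]; rewrite leqNgt; apply/negP=> lt_q.
have : q ^ 3 <= (2 * k) ^ 3 by rewrite leq_exp2r // ltnW.
by rewrite expnMn; nia.
Qed.

(** * Heavy secants through a point of a blocking set *)

Section HeavySecants.
Variables (F : finFieldType) (Pt Ln : finType) (inc : Pt -> Ln -> bool).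
Hypothesis pl : plane #|F| inc.
Hypothesis co : coordinatized F inc.
Implicit Types (P R X : Pt) (L M l : Ln) (B S : {set Pt}) (T : {set Ln}).
Local Notation pts := (points_on inc).
Local Notation pen := (lines_through inc).
Local Notation secant := (secant_size inc).
Local Notation q := #|F|.
Variables (p n k : nat) (B : {set Pt}).
Hypotheses (pr_p : prime p) (cardF : q = p ^ n) (gt16 : 16 < q).
Hypothesis small_k : below_two_thirds p q k.
Hypothesis blkB : forall L, exists2 P, P \in B & inc P L.
Hypothesis nfull : forall L, ~~ (pts L \subset B).
Hypothesis cardB : #|B| = (q + k).+1.

(** A root of multiplicity at least [Q] is a line through [P] with that many points of [B] besides
    [P], hence with more than [Q] in all; multiplicity [q] would be a full line. *)
Lemma heavy_joins P l : P \in B -> inc P l -> (forall R, R \in B -> inc R l -> R = P) ->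
  q + p ^ uphalf n <= #|[set R in B :\ P |
     [exists L, [&& inc P L, inc R L & p ^ uphalf n < secant B L]]]|.
Proof.
move=> BP Pl tanl; have [a [b [cab ca]]] := co Pl.
pose S := B :\ P; set Q := p ^ uphalf n.
have cardS : #|S| = q + k.
  by have := cardsD1 P B; rewrite BP cardB => -[].
have lt_kq : k.+1 < q by have := below_two_thirds_half gt16 small_k; lia.
have Sl R : R \in S -> ~~ inc R l.
  by case/setD1P=> neRP BR; apply: contraNN neRP => /(tanl _ BR)->.
have blkS L : ~~ inc P L -> exists2 R, R \in S & inc R L.
  move=> nPL; have [R BR RL] := blkB L; exists R => //; rewrite in_setD1 BR andbT.
  by apply: contraNneq nPL => <-.
pose rs := [seq (- a R)%R | R <- enum S].
have sz_rs : size rs = q + k by rewrite size_map -cardE.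
have gap i : k < i < q -> ((\prod_(c <- rs) ('X - c%:P))`_i = 0)%R.
  move=> ltki; apply: etrans (affine_gap cab Sl blkS cardS lt_kq ltki).
  rewrite big_map; congr (nth _ (polyseq _) _); apply: eq_bigr => R _.
  by rewrite polyCN opprK.
have count_rs c L : inc P L -> (forall R, ~~ inc R l -> inc R L = (a R == - c)%R) ->
    count_mem c rs < secant B L.
  move=> PL LE; rewrite count_map count_enum /secant_size (cardsD1 P (B :&: pts L)) !inE BP PL ltnS.
  apply/subset_leq_card/subsetP=> R; rewrite !inE => /andP[/andP[neRP BR] /eqP aR].
  by rewrite neRP BR LE ?Sl ?in_setD1 ?neRP // -aR opprK /=.
have heavy := lacunary_heavy_roots pr_p cardF gt16 small_k sz_rs gap.
apply: leq_trans (heavy _) _ => {heavy} [c|].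
  have [L /andP[PL _] LE] := ca (- c)%R; rewrite ltnNge; apply/negP=> le_c.
  case/negP: (nfull L); have := leq_ltn_trans le_c (count_rs c L PL LE).
  rewrite -(plane_line pl L) /secant_size => le_L; apply/setIidPr/eqP.
  by rewrite eqEcard subsetIr.
rewrite count_map count_enum -/Q; apply/subset_leq_card/subsetP=> R.
rewrite inE => /andP[SR le_Q]; rewrite inE SR; apply/existsP.
have [L /andP[PL _] LE] := ca (a R); exists L.
rewrite PL LE ?Sl // eqxx; apply: leq_ltn_trans le_Q (count_rs _ L PL _) => R'.
by rewrite opprK; apply: LE.
Qed.
End HeavySecants.

(* The inequality is [0 <= 2 * \sum_L (n_L - 1) * (n_L - Q - 1) + (Q - 1) * b * (k - Q)]
   for a blocking set of size [b = q + k + 1] with secants of size [n_L]. *)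
Lemma secant_variance_bound p n k (q := p ^ n) (Q := p ^ uphalf n) (b := (q + k).+1) :
    prime p -> 16 < q -> below_two_thirds p q k -> Q <= k ->
    2 * (b * q.+1) * Q.+1
      <= 2 * (b * b.-1) + 2 * Q.+1 * (q ^ 2 + q).+1 + Q.-1 * (b * (k - Q)) ->
  q = Q * Q /\ k = Q.
Proof.
move=> pr_p gt16 small_k le_Qk; have p_gt1 := prime_gt1 pr_p.
have le_2kq := below_two_thirds_half gt16 small_k.
(* [Q^2] is [q] for even [n] and [p q] for odd [n]. *)
have [qE | le_2q] : q = Q * Q \/ 2 * q <= Q * Q.
  rewrite /q /Q -expnD addnn -mul2n; have := odd_double_half n; rewrite -mul2n uphalf_half.
  case: (odd n) => /= nE; [right | left; congr (_ ^ _); lia].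
  have -> : 2 * (1 + n./2) = n.+1 by lia.
  by rewrite expnS leq_mul2r p_gt1 orbT.
- case/andP: small_k => lt_k _; have [c kE] : exists c, k = Q + c by exists (k - Q); rewrite subnKC.
  have lt4Q : 4 < Q by rewrite ltnNge; apply/negP=> leQ4; move: gt16; rewrite qE; nia.
  rewrite /b qE kE addKn /= => le_c; split=> //; case: c => [|c] in kE le_c *; first by rewrite addn0.
  have [Q1 QE] : exists Q1, Q = Q1.+1 by exists Q.-1; rewrite prednK //; lia.
  (* Suppose [k] exceeds [Q] by [c + 1]. Cancelling this factor yields [(Q - 1)^2 <= k], and
     [k^3 < q^2 = Q^4] then gives [(Q - 1)^3 < Q^2], impossible for [Q > 4]. *)
  have le_Qc : Q ^ 3 + 1 <= 2 * Q ^ 2 + 2 * Q + Q.+1 * c.+1.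
    rewrite -(leq_pmul2l (ltn0Sn c)).
    move: le_c; rewrite QE /=; clear; nia.
  have le_k : Q1 ^ 2 <= k.
    move: le_Qc; rewrite kE QE; clear; nia.
  have : Q1 ^ 3 < Q ^ 2.
    rewrite -(ltn_exp2r _ _ (isT : 0 < 2)) -(mulnn Q) -qE expnAC.
    by apply: leq_ltn_trans lt_k; rewrite leq_exp2r.
  rewrite QE in lt4Q *; clear -lt4Q; nia.
- move=> le_b; exfalso; move: le_b; apply/negP; rewrite -ltnNge.
  have lt4Q : 4 < Q by rewrite ltnNge; apply/negP=> leQ4; clear -gt16 leQ4 le_2q; nia.
  have [c kE] : exists c, k = Q + c by exists (k - Q); rewrite subnKC.
  have [Q1 QE] : exists Q1, Q = Q1.+1 by exists Q.-1; rewrite prednK //; lia.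
  have [s sE] : exists s, Q * Q = 2 * q + s by exists (Q * Q - 2 * q); rewrite subnKC.
  have h1 : (Q + c) * (2 * (Q + c) * Q1) <= (Q + c) * (q * Q1).
    by rewrite leq_mul2l leq_mul2r -kE le_2kq !orbT.
  have h2 : (Q + c) * (Q + c) * Q.+1 <= (Q + c) * (Q + c) * (2 * Q1).
    by rewrite leq_mul2l; apply/orP; right; lia.
  have e1 : Q * Q * q = (2 * q + s) * q by rewrite sE.
  have q_gt0 : 0 < q by lia.
  rewrite /b kE addKn /= -!mulnn; move: h1 h2 e1 lt4Q q_gt0 sE; rewrite QE /=.
  by clear; move: q Q1 c s => q' Q' c s; nia.
Qed.

Section PlaneCounts.
Variables (q : nat) (Pt Ln : finType) (inc : Pt -> Ln -> bool).
Hypothesis pl : plane q inc.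
Local Notation pts := (points_on inc).
Local Notation pen := (lines_through inc).
Local Notation secant := (secant_size inc).

Lemma card_points : 0 < #|Pt| -> #|Pt| = (q ^ 2 + q).+1.
Proof.
case/card_gt0P=> X _; have XX : X \notin [set: Pt] :\ X by rewrite !inE eqxx.
have := sum_secant_pencil pl XX; have := cardsD1 X [set: Pt].
rewrite inE cardsT => -> <-; rewrite add1n; congr _.+1.
rewrite (eq_bigr (fun=> q)) => [|L]; first by rewrite sum_nat_const (plane_pencil pl); ring.
rewrite inE => XL; rewrite /secant_size.
have := plane_line pl L; rewrite (cardsD1 X) inE XL add1n => -[<-].
by apply: eq_card => R; rewrite !inE andbT.
Qed.

Lemma card_lines : 0 < #|Pt| -> #|Ln| = (q ^ 2 + q).+1.
Proof.
move=> Pt_gt0; have := sum_secant_all pl [set: Pt].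
rewrite (eq_bigr (fun=> q.+1)) => [|L _]; last by rewrite /secant_size setTI (plane_line pl).
rewrite sum_nat_const cardsT card_points // => /eqP.
by rewrite eqn_pmul2r // => /eqP.
Qed.
End PlaneCounts.

(** Without the last term this says [0 <= 2 (m - 1) (m - Q - 1)], which fails only for [1 < m <= Q];
    the weight [Q - 1] is tight at [m = 2]. *)
Lemma secant_term_bound Q m : 0 < Q -> 0 < m ->
  2 * (m * Q.+1) <= 2 * (m * m.-1) + 2 * Q.+1 +
    (if m <= Q then Q.-1 * (m * m.-1) else 0).
Proof.
case: Q m => // Q [|m] // _ _ /=; case: leqP => lt_mQ.
  have : m * Q.+2 <= m * m.+1 by rewrite leq_mul2l; apply/orP; right.
  by lia.
have : Q.+2 * (2 * m) <= Q.+2 * (m.+1 * m).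
  by rewrite leq_mul2l leq_mul2r; case: m lt_mQ => [|m] _; rewrite ?orbT.
by lia.
Qed.

Lemma secant_term_eq Q m : 0 < m -> (m <= Q -> m = 1) ->
  2 * (m * m.-1) + 2 * Q.+1 <= 2 * (m * Q.+1) -> (m == 1) || (m == Q.+1).
Proof.
case: m => // -[|m] // _ short /=; rewrite eqSS => le_m.
have lt_Qm : Q < m.+2 by rewrite ltnNge; apply/negP=> /short.
have : m.+1 * m.+2 <= m.+1 * Q.+1 by lia.
by rewrite leq_mul2l /= eqn_leq; lia.
Qed.

(** * Secant sizes of a small minimal blocking set *)

Section SmallBlockingSet.
Variables (F : finFieldType) (Pt Ln : finType) (inc : Pt -> Ln -> bool).
Hypothesis pl : plane #|F| inc.
Hypothesis co : coordinatized F inc.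
Implicit Types (P R X : Pt) (L M l : Ln) (B S : {set Pt}) (T : {set Ln}).
Local Notation pts := (points_on inc).
Local Notation pen := (lines_through inc).
Local Notation secant := (secant_size inc).
Local Notation q := #|F|.
Variables (p n k : nat) (B : {set Pt}).
Hypotheses (pr_p : prime p) (cardF : q = p ^ n) (gt16 : 16 < q).
Hypothesis small_k : below_two_thirds p q k.
Hypothesis blkB : forall L, exists2 P, P \in B & inc P L.
Hypothesis minB : forall P, P \in B ->
  exists2 L, inc P L & forall R, R \in B -> inc R L -> R = P.
Hypothesis nfull : forall L, ~~ (pts L \subset B).
Hypothesis cardB : #|B| = (q + k).+1.

Theorem small_blocking_secants :
  exists Q, [/\ q = Q * Q, k = Q & forall L, (secant B L == 1) || (secant B L == Q.+1)].
Proof.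
pose Q := p ^ uphalf n; exists Q; pose short L := secant B L <= Q.
have Q_gt0 : 0 < Q by rewrite expn_gt0 prime_gt0.
have sec_gt0 L : 0 < secant B L.
  by have [R BR RL] := blkB L; apply/card_gt0P; exists R; rewrite !inE BR.
have heavy P : P \in B -> #|[set R in B :\ P | [exists L, [&& inc P L, inc R L & short L]]]|
    + Q <= k.
  move=> BP; have [l Pl tanl] := minB BP.
  have := heavy_joins pl co pr_p cardF gt16 small_k blkB nfull cardB BP Pl tanl.
  rewrite -/Q; set hv := [set R in _ | _]; set sh := [set R in _ | _] => le_hv.
  have := cardsD1 P B; rewrite BP cardB add1n => -[eqBP].
  rewrite -(leq_add2l q) eqBP addnCA.
  apply: leq_trans (leq_add (leqnn _) le_hv) _; rewrite -cardsUI.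
  have -> : sh :&: hv = set0.
    apply/setP=> R; rewrite !inE; apply/negP=> /andP[/andP[/andP[neRP _] /existsP[L /and3P[PL RL sL]]]].
    case/andP=> _ /existsP[M /and3P[PM RM]]; rewrite eq_sym in neRP.
    by rewrite -(plane_uniq pl neRP PL RL PM RM) ltnNge -/(short L) sL.
  by rewrite cards0 addn0 subset_leq_card // subUset /sh /hv !setIdE !subsetIl.
have [P BP] : exists P, P \in B by apply/card_gt0P; rewrite cardB.
have q_gt0 : 0 < q by lia.
have Pt_gt0 : 0 < #|Pt| by apply/card_gt0P; exists P.
have le_Qk : Q <= k by apply: leq_trans (heavy P BP); rewrite leq_addl.
have sum_all : \sum_L secant B L * (secant B L).-1 = #|B| * #|B|.-1.
  rewrite (sum_secant_pairs pl B xpredT) -sum_nat_const; apply: eq_bigr => X BX.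
  have := cardsD1 X B; rewrite BX => ->; rewrite /=; apply: eq_card => R.
  rewrite inE; case: (R \in _) => //=; apply/existsP.
  by have [L /andP[XL RL]] := plane_join pl X R; exists L; rewrite XL RL.
have sum_short : \sum_(L | short L) secant B L * (secant B L).-1 <= #|B| * (k - Q).
  rewrite (sum_secant_pairs pl B short) -sum_nat_const; apply: leq_sum => X BX.
  by rewrite -(leq_add2r Q) subnK // heavy.
have term L : 2 * (secant B L * Q.+1) <= 2 * (secant B L * (secant B L).-1) + 2 * Q.+1 +
    (if short L then Q.-1 * (secant B L * (secant B L).-1) else 0).
  exact: secant_term_bound.
have sum_term : 2 * (#|B| * q.+1) * Q.+1 <= 2 * (#|B| * #|B|.-1) + 2 * Q.+1 * (q ^ 2 + q).+1
    + Q.-1 * \sum_(L | short L) secant B L * (secant B L).-1.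
  rewrite -sum_all -(sum_secant_all pl) -(card_lines pl Pt_gt0).
  rewrite -mulnA big_distrl /= !big_distrr /= [\sum_(L | short L) _]big_mkcond.
  rewrite [2 * _ * _]mulnC -sum_nat_const -!big_split /=.
  by apply: leq_sum => L _; apply: term.
have le_b : 2 * (#|B| * q.+1) * Q.+1 <= 2 * (#|B| * #|B|.-1) + 2 * Q.+1 * (q ^ 2 + q).+1
    + Q.-1 * (#|B| * (k - Q)).
  by apply: leq_trans sum_term _; rewrite leq_add2l leq_mul2l sum_short orbT.
rewrite cardB cardF in le_b; have gt16' : 16 < p ^ n by rewrite -cardF.
have small_k' : below_two_thirds p (p ^ n) k by rewrite -cardF.
have [qE kE] := secant_variance_bound pr_p gt16' small_k' le_Qk le_b.
split=> //; first by rewrite cardF.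
(* Now that [k = Q], the bound on joins by short lines is zero, so short lines are tangents. *)
have short1 L : short L -> secant B L = 1.
  move=> sL; move: sum_short; rewrite kE subnn muln0 leqn0 sum_nat_eq0.
  move/forallP/(_ L); rewrite sL /= muln_eq0 eqn0Ngt sec_gt0 /=.
  by have := sec_gt0 L; case: (secant B L) => [|[]].
(* [f L - g L] is [2 (m - 1) (m - Q - 1)] with [m] the secant size. It is nonnegative now that short
   lines are tangents, and its sum over all lines is zero when [q = Q^2] and [k = Q], so every term
   vanishes. *)
pose f L := 2 * (secant B L * (secant B L).-1) + 2 * Q.+1.
pose g L := 2 * (secant B L * Q.+1).
have le_gf L : g L <= f L.
  have := term L; rewrite -/(f L) -/(g L); case: ifP => [/short1 s1 _|_]; last by rewrite addn0.
  by rewrite /g /f s1; lia.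
have sum0 : \sum_L (f L - g L) = 0.
  rewrite sumnB // /f /g big_split /= -!big_distrr sum_nat_const /= sum_all.
  rewrite -big_distrl /= (sum_secant_all pl) (card_lines pl Pt_gt0) cardB kE cardF qE.
  rewrite -/Q; clear; move: (Q) => Q'; apply/eqP; rewrite subn_eq0 /=.
  apply: eq_leq; ring.
move=> L; have : f L - g L == 0.
  by move/eqP: sum0; rewrite sum_nat_eq0 => /forallP/(_ L).
have := term L; rewrite /f /g; case: ifP => [/short1-> //|_] _.
rewrite subn_eq0; exact: secant_term_eq (sec_gt0 L) (short1 L).
Qed.
End SmallBlockingSet.

Definition collinear (Pt Ln : finType) (inc : Pt -> Ln -> bool) P Q R : bool :=
  [exists L, [&& inc P L, inc Q L & inc R L]].

Definition quadrangle (Pt Ln : finType) (inc : Pt -> Ln -> bool) (S : {set Pt}) : Prop :=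
  exists P1 P2 P3 P4,
    [/\ [&& P1 \in S, P2 \in S, P3 \in S & P4 \in S],
        ~~ collinear inc P1 P2 P3, ~~ collinear inc P1 P2 P4,
        ~~ collinear inc P1 P3 P4 & ~~ collinear inc P2 P3 P4].

Definition subplane (Pt Ln : finType) (inc : Pt -> Ln -> bool)
    (S : {set Pt}) (T : {set Ln}) (n : nat) : Prop :=
  [/\ forall P Q, P \in S -> Q \in S -> P != Q -> exists2 L, L \in T & inc P L && inc Q L,
      forall L M, L \in T -> M \in T -> L != M -> exists2 P, P \in S & inc P L && inc P M,
      quadrangle inc S &
      forall L, L \in T -> #|S :&: [set P | inc P L]| = n.+1].

(** * Baer subplanes from secant sizes *)

Section Subplanes.
Variables (q : nat) (Pt Ln : finType) (inc : Pt -> Ln -> bool).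
Hypothesis pl : plane q inc.
Implicit Types (P R X : Pt) (L M : Ln) (B S : {set Pt}) (T : {set Ln}).
Local Notation pts := (points_on inc).
Local Notation pen := (lines_through inc).
Local Notation secant := (secant_size inc).

Lemma meet_uniq P R L M :
  L != M -> inc P L -> inc R L -> inc P M -> inc R M -> P = R.
Proof.
move=> neLM PL RL PM RM; apply/eqP; apply: contraNT neLM => nePR; apply/eqP.
exact: (plane_uniq pl nePR).
Qed.

Lemma quadrangle_of_lines S T n L M :
    (forall L M, L \in T -> M \in T -> L != M -> exists2 P, P \in S & inc P L && inc P M) ->
    (forall L, L \in T -> secant S L = n.+1) -> 1 < n ->
    L \in T -> M \in T -> L != M ->
  quadrangle inc S.
Proof.
move=> mtT secT n_gt1 TL TM neLM; have [O SO /andP[OL OM]] := mtT L M TL TM neLM.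
have two N : N \in T -> inc O N -> exists P R, [/\ P \in S, R \in S, P != O, R != O &
    [/\ P != R, inc P N & inc R N]].
  move=> TN ON; have := secT N TN.
  rewrite /secant_size (cardsD1 O) !inE SO ON add1n => -[cN].
  have : 1 < #|(S :&: pts N) :\ O| by rewrite cN.
  case/card_gt1P=> P [R []]; rewrite !inE => /and3P[PO SP PN] /and3P[RO SR RN] nePR.
  by exists P, R; split.
have [P1 [P2 [S1 S2 O1 O2 [ne12 L1 L2]]]] := two L TL OL.
have [P3 [P4 [S3 S4 O3 O4 [ne34 M3 M4]]]] := two M TM OM.
have offM P : P != O -> inc P L -> ~~ inc P M.
  by move=> PO PL; apply: contraNN PO => PM; rewrite (meet_uniq neLM PL OL PM OM).
have offL P : P != O -> inc P M -> ~~ inc P L.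
  by move=> PO PM; apply: contraNN PO => PL; rewrite (meet_uniq neLM PL OL PM OM).
exists P1, P2, P3, P4; split; first by rewrite S1 S2 S3 S4.
- apply/existsP=> -[N /and3P[N1 N2 N3]]; move: (offL P3 O3 M3).
  by rewrite -(plane_uniq pl ne12 N1 N2 L1 L2) N3.
- apply/existsP=> -[N /and3P[N1 N2 N4]]; move: (offL P4 O4 M4).
  by rewrite -(plane_uniq pl ne12 N1 N2 L1 L2) N4.
- apply/existsP=> -[N /and3P[N1 N3 N4]]; move: (offM P1 O1 L1).
  by rewrite -(plane_uniq pl ne34 N3 N4 M3 M4) N1.
- apply/existsP=> -[N /and3P[N2 N3 N4]]; move: (offM P2 O2 L2).
  by rewrite -(plane_uniq pl ne34 N3 N4 M3 M4) N2.
Qed.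

Section Baer.
Variables (Q : nat) (B : {set Pt}).
Hypotheses (Q_gt1 : 1 < Q) (qE : q = Q * Q) (cardB : #|B| = (q + Q).+1).
Hypothesis secB : forall L, (secant B L == 1) || (secant B L == Q.+1).
Let T := [set L | secant B L == Q.+1].
Let Q_gt0 : 0 < Q := ltnW Q_gt1.

(** Seen from [P], each line of [T] carries [Q] further points and a tangent none, and there are
    [q + Q = Q (Q + 1)] of them. *)
Lemma baer_point_in P : P \in B -> #|T :&: pen P| = Q.+1.
Proof.
move=> BP; have nP : P \notin B :\ P by rewrite !inE eqxx.
have := sum_secant_pencil pl nP; have := cardsD1 P B; rewrite BP cardB add1n => -[<-].
rewrite (eq_bigr (fun L => if L \in T then Q else 0)) => [|L]; last first.
  rewrite inE => PL; have := secB L; rewrite inE.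
  have -> : secant B L = (secant (B :\ P) L).+1.
    rewrite /secant_size (cardsD1 P (B :&: pts L)) !inE BP PL add1n; congr _.+1.
    by apply: eq_card => R; rewrite !inE andbA.
  by rewrite !eqSS orbC; case: eqVneq => [-> | _ /eqP].
rewrite -big_mkcondr /= sum_nat_cond_const => eqQ.
have -> : #|T :&: pen P| = #|[set L in pen P | L \in T]|.
  by apply: eq_card => L; rewrite !inE andbC.
by apply/eqP; rewrite -(eqn_pmul2r Q_gt0) eqQ qE mulSn addnC.
Qed.

(** The [q + 1] lines through [X] each carry one point of [B], a line of [T] carries [Q] more, and
    [(q + 1) + Q] leaves room for just one of these. *)
Lemma baer_point_out X : X \notin B -> #|T :&: pen X| = 1.
Proof.
move=> BX; have := sum_secant_pencil pl BX; rewrite cardB.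
rewrite (eq_bigr (fun L => 1 + if L \in T then Q else 0)) => [|L _]; last first.
  by have := secB L; rewrite inE orbC; case: eqVneq => [-> | _ /eqP->].
rewrite big_split sum1_card (plane_pencil pl) /= -big_mkcondr /= sum_nat_cond_const.
rewrite addSn => -[] /eqP; rewrite eqn_add2l => /eqP eqQ.
have -> : #|T :&: pen X| = #|[set L in pen X | L \in T]|.
  by apply: eq_card => L; rewrite !inE andbC.
by apply/eqP; rewrite -(eqn_pmul2r Q_gt0) eqQ mul1n.
Qed.

Lemma baer_meet L M : L \in T -> M \in T -> L != M -> exists2 P, P \in B & inc P L && inc P M.
Proof.
move=> TL TM neLM; have [P /andP[PL PM]] := plane_meet pl L M.
exists P; rewrite ?PL //; apply: contraNT neLM => /baer_point_out/eqP/cards1P[N eN].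
have LN : L \in T :&: pen P by rewrite in_setI TL inE.
have MN : M \in T :&: pen P by rewrite in_setI TM inE.
by move: LN MN; rewrite eN !inE => /eqP-> /eqP->.
Qed.

Lemma baer_join P R : P \in B -> R \in B -> P != R -> exists2 L, L \in T & inc P L && inc R L.
Proof.
move=> BP BR nePR; have [L /andP[PL RL]] := plane_join pl P R.
exists L; rewrite ?PL // inE; have := secB L; case: eqP => //= sec1 _.
have : #|[set P; R]| <= secant B L.
  by apply/subset_leq_card/subsetP=> X; rewrite !inE => /orP[]/eqP->; rewrite ?BP ?BR.
by rewrite cards2 nePR sec1.
Qed.
End Baer.
End Subplanes.

(** By [baer_point_in] points and lines play symmetric roles. The dual form is needed when the
    classification is applied to the dual plane and a subplane of the original one must be
    recovered. *)
Theorem baer_of_secants q Pt Ln inc Q (B : {set Pt}) :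
    @plane q Pt Ln inc -> 1 < Q -> q = Q * Q -> #|B| = (q + Q).+1 ->
    (forall L, (secant_size inc B L == 1) || (secant_size inc B L == Q.+1)) ->
  let T := [set L | secant_size inc B L == Q.+1] in
  subplane inc B T Q /\ subplane (fun L P => inc P L) T B Q.
Proof.
move=> pl Q_gt1 qE cardB secB T.
have secT L : L \in T -> secant_size inc B L = Q.+1 by rewrite inE => /eqP.
have secP P : P \in B -> secant_size (fun L P => inc P L) T P = Q.+1.
  by move=> BP; exact: (baer_point_in pl Q_gt1 qE cardB secB BP).
have mt L M : L \in T -> M \in T -> L != M -> exists2 P, P \in B & inc P L && inc P M.
  exact: (baer_meet pl Q_gt1 cardB secB).
have jn P R : P \in B -> R \in B -> P != R -> exists2 L, L \in T & inc P L && inc R L.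
  exact: (baer_join pl secB).
have /card_gt1P[P [R [BP BR nePR]]] : 1 < #|B| by rewrite cardB; lia.
have /card_gt1P[L [M [/setIP[TL _] /setIP[TM _] neLM]]] : 1 < #|T :&: lines_through inc P|.
  by have := secP P BP; rewrite /secant_size => ->; lia.
split; split=> //; first exact: (quadrangle_of_lines pl mt secT Q_gt1 TL TM neLM).
exact: (quadrangle_of_lines (plane_dual pl) jn secP Q_gt1 BP BR nePR).
Qed.

(** Projection from [P] maps the lines of [T] through [P] bijectively onto the points of [S] on a
    line of [T] off [P], so all points have degree [n + 1]. This gives the size of a dominating set
    built from a given Baer subplane. *)
Theorem card_subplane q Pt Ln inc n (S : {set Pt}) (T : {set Ln}) :
  @plane q Pt Ln inc -> subplane inc S T n -> #|S| = (n ^ 2 + n).+1 /\ #|T| = (n ^ 2 + n).+1.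
Proof.
move=> pl [jn mt [P1 [P2 [P3 [P4 [/and4P[S1 S2 S3 S4] c123 c124 c134 c234]]]]] secT].
have ne12 : P1 != P2.
  apply: contraNneq c123 => <-; have [L /andP[L1 L3]] := plane_join pl P1 P3.
  by apply/existsP; exists L; rewrite L1 L3.
have ne13 : P1 != P3.
  apply: contraNneq c123 => <-; have [L /andP[L1 L2]] := plane_join pl P1 P2.
  by apply/existsP; exists L; rewrite L1 L2.
have ne23 : P2 != P3.
  apply: contraNneq c123 => <-; have [L /andP[L1 L2]] := plane_join pl P1 P2.
  by apply/existsP; exists L; rewrite L1 L2.
have off P : exists2 L, L \in T & ~~ inc P L.
  have [L12 T12 /andP[i1 i2]] := jn _ _ S1 S2 ne12.
  have [L13 T13 /andP[j1 j3]] := jn _ _ S1 S3 ne13.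
  have [L23 T23 /andP[k2 k3]] := jn _ _ S2 S3 ne23.
  have [P12|] := boolP (inc P L12); last by exists L12.
  have [P13|] := boolP (inc P L13); last by exists L13.
  have [P23|] := boolP (inc P L23); last by exists L23.
  case/negP: c123; apply/existsP; have [eP|neP] := eqVneq P P1.
    by exists L23; rewrite -eP P23 k2.
  by exists L12; rewrite i1 i2 (plane_uniq pl neP P12 i1 P13 j1).
have deg P : P \in S -> #|T :&: lines_through inc P| = n.+1.
  move=> SP; have [M TM PM] := off P; rewrite -(secT M TM).
  have PL_M L : L \in T :&: lines_through inc P -> L != M.
    by rewrite !inE => /andP[_ PL]; apply: contraNneq PM => <-.
  pose g L := odflt P [pick R in S :&: points_on inc M | inc R L].
  have gE L : L \in T :&: lines_through inc P -> (g L \in S :&: points_on inc M) && inc (g L) L.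
    move=> PL; rewrite /g; case: pickP => [R //|none] /=.
    have TL : L \in T by case/setIP: PL.
    have [R SR /andP[RL RM]] := mt L M TL TM (PL_M L PL).
    by have := none R; rewrite !inE SR RM RL.
  have gP L : L \in T :&: lines_through inc P -> g L != P.
    by case/gE/andP => + _; apply: contraTneq => ->; rewrite !inE (negPf PM) andbF.
  have inj_g : {in T :&: lines_through inc P &, injective g}.
    move=> L L' PL PL' eg; have := gP L PL; rewrite eq_sym => nePg.
    have /andP[_ gL] := gE L PL; have /andP[_ gL'] := gE L' PL'.
    move: PL PL'; rewrite !inE => /andP[_ PL] /andP[_ PL'].
    by apply: (plane_uniq pl nePg PL gL PL'); rewrite eg.
  rewrite -(card_in_imset inj_g); apply: eq_card => R; apply/imsetP/idP.
    by case=> L PL ->; case/andP: (gE L PL).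
  rewrite !inE => /andP[SR RM].
  have nePR : P != R by apply: contraNneq PM => ->.
  have [L TL /andP[PL RL]] := jn P R SP SR nePR.
  have LT : L \in T :&: lines_through inc P by rewrite in_setI TL inE.
  exists L => //; have /andP[] := gE L LT; rewrite !inE => /andP[_ gM] gL.
  exact: (meet_uniq pl (PL_M L LT) RL gL RM gM).
have cardS : #|S| = (n ^ 2 + n).+1.
  have nP : P1 \notin S :\ P1 by rewrite !inE eqxx.
  have := sum_secant_pencil pl nP; rewrite (cardsD1 P1 S) S1 add1n => <-; congr _.+1.
  rewrite (eq_bigr (fun L => if L \in T then n else 0)) => [|L]; last first.
    rewrite inE => P1L; case: ifP => [TL|nTL].
      have := secT L TL; rewrite (cardsD1 P1) !inE S1 P1L add1n => -[<-].
      by apply: eq_card => R; rewrite !inE andbA.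
    apply/eqP; rewrite cards_eq0 -subset0; apply/subsetP=> R.
    rewrite !inE => /andP[/andP[neRP SR] RL]; rewrite eq_sym in neRP.
    have [M TM /andP[P1M RM]] := jn _ _ S1 SR neRP.
    by rewrite (plane_uniq pl neRP P1L RL P1M RM) TM in nTL.
  rewrite -big_mkcondr /= sum_nat_cond_const.
  have -> : #|[set L in lines_through inc P1 | L \in T]| = #|T :&: lines_through inc P1|.
    by apply: eq_card => L; rewrite !inE andbC.
  by rewrite deg // mulSn -mulnn addnC.
split=> //; have := sum_secant inc S T.
rewrite (eq_bigr (fun=> n.+1)) => [|L TL]; last exact: secT.
rewrite [RHS](eq_bigr (fun=> n.+1)) => [|P SP]; last exact: deg.
by rewrite !sum_nat_const => /eqP; rewrite eqn_pmul2r // cardS => /eqP.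
Qed.

(** * Dominating sets *)

Section Domination.
Variables (Pt Ln : finType) (inc : Pt -> Ln -> bool).
Implicit Types (Pd : {set Pt}) (Ld : {set Ln}).

Definition dom Pd Ld : Prop :=
  (forall P, P \notin Pd -> exists2 L, L \in Ld & inc P L) /\
  (forall L, L \notin Ld -> exists2 P, P \in Pd & inc P L).

Definition min_dom Pd Ld : Prop :=
  dom Pd Ld /\
  forall Pd' Ld', Pd' \subset Pd -> Ld' \subset Ld -> dom Pd' Ld' -> Pd' = Pd /\ Ld' = Ld.

Definition destabilized Pd Ld : Prop :=
  exists Pd1 Pd2 Ld1 Ld2,
    [/\ Pd \subset Pd1, Ld \subset Ld1, dom Pd1 Ld1,
        #|Pd1| + #|Ld1| = (#|Pd| + #|Ld|).+1 &
        [/\ Pd2 \subset Pd1, Ld2 \subset Ld1, dom Pd2 Ld2 &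
            #|Pd2| + #|Ld2| < #|Pd| + #|Ld| ]].

Lemma setU1_of_card (T : finType) (A B : {set T}) :
  A \subset B -> #|B| = #|A|.+1 -> exists2 z, z \notin A & B = z |: A.
Proof.
move=> sAB cB; have : #|B :\: A| == 1 by rewrite cardsD (setIidPr sAB) cB subSnn.
case/cards1P=> z eD; have : z \in B :\: A by rewrite eD set11.
rewrite inE => /andP[nAz _]; exists z => //.
by rewrite -{1}(setID B A) eD (setIidPr sAB) setUC.
Qed.

Lemma not_destabilized Pd Ld :
    (forall z Pd2 Ld2, z \notin Pd -> Pd2 \subset z |: Pd -> Ld2 \subset Ld ->
       dom Pd2 Ld2 -> #|Pd| + #|Ld| <= #|Pd2| + #|Ld2|) ->
    (forall z Pd2 Ld2, z \notin Ld -> Pd2 \subset Pd -> Ld2 \subset z |: Ld ->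
       dom Pd2 Ld2 -> #|Pd| + #|Ld| <= #|Pd2| + #|Ld2|) ->
  ~ destabilized Pd Ld.
Proof.
move=> addP addL [Pd1 [Pd2 [Ld1 [Ld2 [sP sL _ eqs [sP2 sL2 dom2]]]]]].
rewrite ltnNge => /negP; apply.
have lP := subset_leq_card sP; have lL := subset_leq_card sL.
have [cP | cL] : #|Pd1| = #|Pd|.+1 /\ #|Ld1| = #|Ld| \/ #|Pd1| = #|Pd| /\ #|Ld1| = #|Ld|.+1 by lia.
  case: cP => cP cL; have [z nz eP] := setU1_of_card sP cP.
  have eL : Ld = Ld1 by apply/eqP; rewrite eqEcard sL cL leqnn.
  by apply: addP nz _ _ dom2; rewrite ?eL -?eP.
case: cL => cP cL; have [z nz eL] := setU1_of_card sL cL.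
have eP : Pd = Pd1 by apply/eqP; rewrite eqEcard sP cP leqnn.
by apply: addL nz _ _ dom2; rewrite ?eP -?eL.
Qed.
End Domination.

Lemma dom_dual Pt Ln inc (Pd : {set Pt}) (Ld : {set Ln}) :
  dom inc Pd Ld -> dom (fun L P => inc P L) Ld Pd.
Proof. by case. Qed.

Lemma min_dom_dual Pt Ln inc (Pd : {set Pt}) (Ld : {set Ln}) :
  min_dom inc Pd Ld -> min_dom (fun L P => inc P L) Ld Pd.
Proof.
case=> /dom_dual dD minD; split=> // Ld' Pd' sL sP /dom_dual dD'.
by have [-> ->] := minD Pd' Ld' sP sL dD'.
Qed.

Section Primal.
Variables (F : finFieldType) (Pt Ln : finType) (inc : Pt -> Ln -> bool).
Hypothesis pl : plane #|F| inc.
Hypothesis co : coordinatized F inc.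
Implicit Types (P R X : Pt) (L M l m : Ln) (B S : {set Pt}) (T : {set Ln}).
Local Notation pts := (points_on inc).
Local Notation pen := (lines_through inc).
Local Notation secant := (secant_size inc).
Local Notation q := #|F|.
Hypothesis q_gt2 : 2 < q.

Definition blocks (B : {set Pt}) := forall L, exists2 P, P \in B & inc P L.
(** Once the full pencil of [P] is present, this is all that domination asks of the points. *)
Definition blocks_off P S := forall L, ~~ inc P L -> exists2 R, R \in S & inc R L.

Lemma missedP S L : reflect (forall R, R \in S -> ~~ inc R L) [disjoint S & pts L].
Proof.
apply: (iffP idP) => [/disjoint_setI0/setP dSL R SR | nSL].
  by have := dSL R; rewrite !inE SR /= => ->.
by apply/pred0P=> R /=; rewrite inE; apply/negP=> /andP[/nSL/negPf->].
Qed.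

Lemma missed_bound S : 2 * q <= #|S| + #|[set L | [disjoint S & pts L]]| \/ blocks S.
Proof.
have [U0 | nzU] := eqVneq [set L | [disjoint S & pts L]] set0; last first.
  by left; apply: (missed_lines_bound pl co).
right=> L; have := in_set0 L; rewrite -U0 inE => /negbT/pred0Pn[R /andP[SR]].
by rewrite /= inE => RL; exists R.
Qed.

Lemma other_line P l : exists2 L, L != l & inc P L.
Proof.
have : 0 < #|pen P :\ l|.
  by have := plane_pencil pl P; rewrite -/(pen P) (cardsD1 l); case: (l \in _); lia.
by case/card_gt0P=> L; rewrite !inE => /andP[neL PL]; exists L.
Qed.

Lemma other_point P l : exists2 R, R != P & inc R l.
Proof.
have : 0 < #|pts l :\ P|.
  by have := plane_line pl l; rewrite -/(pts l) (cardsD1 P); case: (P \in _); lia.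
by case/card_gt0P=> R; rewrite !inE => /andP[neR Rl]; exists R.
Qed.

Section Star.
Variables (P : Pt) (l : Ln).
Hypothesis Pl : inc P l.

Lemma blocks_off_punctured_line : blocks_off P (pts l :\ P).
Proof.
move=> L nPL; have [R /andP[RL Rl]] := plane_meet pl L l.
by exists R => //; rewrite !inE Rl andbT; apply: contraNneq nPL => <-.
Qed.

Lemma dom_star S : pts l :\ P \subset S -> dom inc S (pen P :\ l).
Proof.
move=> sS; split=> [R nSR | L].
  have [-> | neRP] := eqVneq R P.
    by have [L neL PL] := other_line P l; exists L; rewrite // !inE neL.
  have [L /andP[RL PL]] := plane_join pl R P; exists L; rewrite // !inE PL andbT.
  apply: contraNneq nSR => eL; apply: (subsetP sS); rewrite !inE neRP -eL //.
rewrite !inE negb_and negbK => /orP[/eqP-> | nPL].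
  have [R neR Rl] := other_point P l; exists R => //.
  by apply: (subsetP sS); rewrite !inE neR.
have [R SR RL] := blocks_off_punctured_line nPL.
by exists R => //; apply: (subsetP sS).
Qed.

Lemma star_add_line z (Pd2 : {set Pt}) (Ld2 : {set Ln}) :
    z \notin pen P :\ l -> Pd2 \subset pts l :\ P -> Ld2 \subset z |: (pen P :\ l) ->
    dom inc Pd2 Ld2 ->
  #|pts l :\ P| + #|pen P :\ l| <= #|Pd2| + #|Ld2|.
Proof.
move=> nz sP sL [domP domL]; apply: leq_add; apply: subset_leq_card.
  apply/subsetP=> R; rewrite !inE => /andP[neRP Rl]; apply/negPn/negP=> nR.
  have : 0 < #|(pen R :\ l) :\ z|.
    have := plane_pencil pl R; rewrite -/(pen R) (cardsD1 l) (cardsD1 z (_ :\ _)).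
    by case: (l \in _); case: (z \in _); lia.
  case/card_gt0P=> L; rewrite !inE => /and3P[neLz neLl RL].
  have nPL : ~~ inc P L.
    apply: contraNN neLl => PL; apply/eqP; exact: (plane_uniq pl neRP RL PL Rl Pl).
  have nL : L \notin Ld2.
    by apply: contra (subsetP sL L) _; rewrite !inE (negPf neLz) (negPf nPL) andbF.
  have [X X2 XL] := domL L nL; have := subsetP sP X X2; rewrite !inE => /andP[_ Xl].
  by case/negP: nR; rewrite -(meet_uniq pl neLl XL RL Xl Rl).
apply/subsetP=> m /[dup] mem_m; rewrite !inE => /andP[neml Pm]; apply/negPn/negP=> nm.
have : 1 < #|pts m :\ P|.
  by have := plane_line pl m; rewrite -/(pts m) (cardsD1 P) inE Pm; lia.
case/card_gt1P=> R [R' [mR mR' neRR']].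
have onz X : X \in pts m :\ P -> inc X z.
  rewrite !inE => /andP[neXP Xm]; have nX : X \notin Pd2.
    apply: contra (subsetP sP X) _; rewrite !inE neXP /=.
    by apply: contraNN neXP => Xl; rewrite (meet_uniq pl neml Xm Pm Xl Pl).
  have [L L2 XL] := domP X nX; have := subsetP sL L L2; rewrite !inE.
  case/orP=> [/eqP<- // | /andP[_ PL]]; case/negP: nm.
  by rewrite -(plane_uniq pl neXP XL PL Xm Pm).
have := onz _ mR; have := onz _ mR'; move: mR mR'; rewrite !inE.
move=> /andP[_ Rm] /andP[_ R'm] R'z Rz; case/negP: nz.
by rewrite (plane_uniq pl neRR' Rz R'z Rm R'm).
Qed.
End Star.

Lemma blocks_offW P S : blocks (P |: S) -> blocks_off P S.
Proof.
move=> blk L nPL; have [R] := blk L; rewrite !inE => /orP[/eqP->|SR RL].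
  by move=> PL; rewrite PL in nPL.
by exists R.
Qed.

Lemma dom_pencil P S : blocks_off P S -> dom inc S (pen P).
Proof.
move=> blk; split=> [R _ | L]; last by rewrite inE; apply: blk.
by have [L /andP[PL RL]] := plane_join pl P R; exists L; rewrite // inE.
Qed.

(** * Minimal dominating sets whose lines form a full pencil *)

Section Pencil.
Variables (P : Pt) (Pd : {set Pt}).
Hypothesis minD : min_dom inc Pd (pen P).

Lemma pencil_blocks_off : blocks_off P Pd.
Proof. by case: minD => -[_ domL] _ L nPL; apply: domL; rewrite inE. Qed.

Lemma pencil_minimal S : S \subset Pd -> blocks_off P S -> S = Pd.
Proof. by move=> sS /dom_pencil dS; have [] := minD.2 S (pen P) sS (subxx _) dS. Qed.

Lemma pencil_center : P \notin Pd.
Proof.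
apply/negP=> PdP; have: Pd :\ P = Pd; last by move/setP/(_ P); rewrite !inE eqxx PdP.
apply: pencil_minimal (subsetDl _ _) _ => L nPL.
have [R PdR RL] := pencil_blocks_off nPL; exists R; rewrite // !inE PdR andbT.
by apply: contraNneq nPL => <-.
Qed.

Lemma pencil_line_sub l : inc P l -> ~~ (pts l :\ P \subset Pd).
Proof.
move=> Pl; apply/negP=> sl; have dS := dom_star sl.
have [_ /setP/(_ l)] := minD.2 Pd _ (subxx _) (subsetDl _ _) dS.
by rewrite !inE eqxx Pl.
Qed.

Lemma pencil_essential R : R \in Pd ->
  exists2 L, ~~ inc P L & inc R L /\ forall R', R' \in Pd -> inc R' L -> R' = R.
Proof.
move=> PdR; have : ~~ [forall L, ~~ inc P L ==> ~~ [disjoint Pd :\ R & pts L]].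
  apply/negP=> /forallP blkR; have: Pd :\ R = Pd; last by move/setP/(_ R); rewrite !inE eqxx PdR.
  apply: pencil_minimal (subsetDl _ _) _ => L nPL.
  have := blkR L; rewrite nPL => /pred0Pn[X /andP[SX]]; rewrite /= inE => XL.
  by exists X.
case/forallPn=> L; rewrite negb_imply negbK => /andP[nPL /missedP miss].
have uniqR X : X \in Pd -> inc X L -> X = R.
  move=> PdX XL; apply/eqP; apply: contraTT XL => neXR; apply: miss.
  by rewrite !inE neXR.
exists L => //; split=> //; have [X PdX XL] := pencil_blocks_off nPL.
by rewrite -(uniqR X PdX XL).
Qed.

Lemma pencil_blocks : blocks (P |: Pd).
Proof.
move=> L; have [PL | nPL] := boolP (inc P L); first by exists P; rewrite ?setU11.
by have [R PdR RL] := pencil_blocks_off nPL; exists R; rewrite // !inE PdR orbT.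
Qed.

(** A full line inside the blocking set [P |: Pd] avoids [P] and then is all of [Pd] by minimality.
    Failing that, [B] is [Pd] if it blocks and [P |: Pd] if not; points of [Pd] are essential
    because [pencil_essential] gives them tangents off [P]. *)
Lemma pencil_shape :
  (exists2 l, ~~ inc P l & Pd = pts l) \/
  exists B : {set Pt}, [/\ blocks B, forall L, ~~ (pts L \subset B),
    forall B' : {set Pt}, B' \proper B -> ~ blocks B',
    Pd \subset B & B \subset P |: Pd].
Proof.
have [/existsP[l sl] | /existsPn nfull] := boolP [exists l, pts l \subset P |: Pd].
  left; exists l; last first.
    have Pl : ~~ inc P l.
      apply/negP=> Pl; case/negP: (pencil_line_sub Pl); apply/subsetP=> R.
      by rewrite !inE => /andP[neRP Rl]; have := subsetP sl R; rewrite !inE Rl (negPf neRP) => /(_ isT).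
    apply/esym/pencil_minimal => [|L nPL].
      apply/subsetP=> R; rewrite inE => Rl; have := subsetP sl R; rewrite !inE => /(_ Rl).
      by case/orP=> [/eqP eR|//]; rewrite -eR Rl in Pl.
    by have [R /andP[RL Rl]] := plane_meet pl L l; exists R; rewrite // inE.
  apply/negP=> Pl; case/negP: (pencil_line_sub Pl); apply/subsetP=> R.
  by rewrite !inE => /andP[neRP Rl]; have := subsetP sl R; rewrite !inE Rl (negPf neRP) => /(_ isT).
right; have ess B B' : Pd \subset B -> B \subset P |: Pd -> B' \proper B -> blocks B' ->
    exists2 X, X \in B :\: B' & X \notin Pd.
  move=> sPdB sBP /properP[sB [X BX nX]] blk'; exists X; first by rewrite inE nX.
  apply/negP=> PdX; have [L nPL [XL uX]] := pencil_essential PdX.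
  have [Y B'Y YL] := blk' L; have := subsetP sBP Y (subsetP sB Y B'Y).
  rewrite !inE => /orP[/eqP eY | PdY]; first by rewrite -eY YL in nPL.
  by rewrite -(uX Y PdY YL) B'Y in nX.
have [blkPd | nblk] := boolP [forall L, ~~ [disjoint Pd & pts L]].
  exists Pd; split=> //; [|move=> L|move=> B' pB' blk'|exact: subsetUr].
  - move=> L; have /pred0Pn[R /andP[PdR]] := forallP blkPd L.
    by rewrite /= inE => RL; exists R.
  - by apply: contra (nfull L) => sL; apply: subset_trans sL (subsetUr _ _).
  have [X] := ess Pd B' (subxx _) (subsetUr _ _) pB' blk'.
  by rewrite inE => /andP[_ ->].
exists (P |: Pd); split=> //; [exact: pencil_blocks | | exact: subsetUr].
move=> B' pB' blk'; have [X] := ess _ B' (subsetUr _ _) (subxx _) pB' blk'.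
rewrite !inE => /andP[nX /orP[/eqP eX|->] //] _; case/negP: nblk; apply/forallP=> L.
have [R B'R RL] := blk' L; apply/pred0Pn; exists R; rewrite /= [in X in _ && X]inE RL andbT.
have := subsetP (proper_sub pB') R B'R; rewrite !inE => /orP[/eqP eR|//].
by rewrite eX -eR B'R in nX.
Qed.

(** The bound [2 q - 3] lies just below two estimates. If points are dropped, [P |: Pd2] can miss
    only [z], so [Pd2] has at least [2 q - 2] points. If two lines of the pencil are dropped, each
    carries [q - 1] points of [Pd], away from [P] and [z]. *)
Lemma pencil_add_line z (Pd2 : {set Pt}) (Ld2 : {set Ln}) :
    #|Pd| <= 2 * q - 3 ->
    z \notin pen P -> Pd2 \subset Pd -> Ld2 \subset z |: pen P -> dom inc Pd2 Ld2 ->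
  #|Pd| + #|pen P| <= #|Pd2| + #|Ld2|.
Proof.
move=> small nz sP sL dom2; have [domP domL] := dom2.
have nPz : ~~ inc P z by move: nz; rewrite inE.
have [eP | neP] := eqVneq Pd2 Pd; last first.
  have blk2 L : ~~ inc P L -> L != z -> exists2 R, R \in Pd2 & inc R L.
    move=> nPL neLz; apply: domL; apply: contra (subsetP sL L) _.
    by rewrite !inE (negPf neLz) (negPf nPL).
  have [bd | /blocks_offW/(pencil_minimal sP)/eqP] := missed_bound (P |: Pd2); last first.
    by rewrite (negPf neP).
  have : #|[set L | [disjoint P |: Pd2 & pts L]]| <= #|[set z]|.
    apply/subset_leq_card/subsetP=> L; rewrite !inE => /missedP miss.
    apply/negPn/negP=> neLz; have nPL := miss P (setU11 _ _).
    have [R R2 RL] := blk2 L nPL neLz; have := miss R.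
    by rewrite !inE R2 orbT RL => /(_ isT).
  have := subset_leq_card sP; have := (leq_card_setU [set P] Pd2).1; rewrite !cards1.
  by move: bd small; lia.
rewrite {Pd2}eP in sP dom2 domP domL *; rewrite leq_add2l leqNgt; apply/negP=> lt2.
have [z2 | nz2] := boolP (z \in Ld2); last first.
  have sL' : Ld2 \subset pen P.
    apply/subsetP=> L L2; have := subsetP sL L L2; rewrite !inE => /orP[/eqP eL|//].
    by rewrite -eL L2 in nz2.
  by have [_ eL] := minD.2 _ _ (subxx _) sL' dom2; rewrite eL ltnn in lt2.
have : 1 < #|pen P :\: Ld2|.
  have : #|Ld2| = (#|Ld2 :&: pen P|).+1.
    rewrite (cardsD1 z Ld2) z2 add1n; congr _.+1; apply: eq_card => L; rewrite !inE.
    case: (eqVneq L z) => [->|neL]; first by rewrite (negPf nPz) andbF.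
    have [L2 /=|//] := boolP (L \in Ld2).
    by have := subsetP sL L L2; rewrite !inE (negPf neL) /= => ->.
  by have := cardsID Ld2 (pen P); rewrite setIC; lia.
case/card_gt1P=> m1 [m2 []]; rewrite !inE => /andP[n1 P1] /andP[n2 P2] nem.
have sec m : m \notin Ld2 -> inc P m -> q.-1 <= secant Pd m.
  move=> nm Pm; have [X /andP[Xm Xz]] := plane_meet pl m z.
  have := plane_line pl m; rewrite (cardsD1 P) (cardsD1 X (_ :\ _)) inE Pm.
  have neXP : X != P by apply: contraNneq nPz => <-.
  rewrite !inE neXP Xm /= => -[<-] /=; apply/subset_leq_card/subsetP=> R.
  rewrite !inE => /and3P[neRX neRP Rm]; rewrite Rm andbT; apply/negPn/negP=> nR.
  have [L L2 RL] := domP R nR; have := subsetP sL L L2; rewrite !inE.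
  have nemL : m != L by apply: contraNneq nm => ->.
  case/orP=> [/eqP eL | PL].
    by case/eqP: neRX; apply: (meet_uniq pl nemL Rm _ RL); rewrite // eL.
  by case/eqP: neRP; apply: (meet_uniq pl nemL Rm Pm RL PL).
have : secant Pd m1 + secant Pd m2 <= #|Pd|.
  rewrite /secant_size -cardsUI -setIIr -setIUr (_ : pts m1 :&: pts m2 = [set P]).
    by rewrite (_ : Pd :&: [set P] = set0) ?cards0 ?addn0 ?subset_leq_card ?subsetIl //;
      apply/setP=> R; rewrite !inE; case: eqVneq => [->|]; rewrite ?andbF // (negPf pencil_center).
  apply/setP=> R; rewrite !inE; apply/andP/eqP=> [[R1 R2]|->//].
  exact: (meet_uniq pl nem R1 P1 R2 P2).
by have := sec m1 n1 P1; have := sec m2 n2 P2; move: small; lia.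
Qed.

(** If the pencil is kept, each [R] in [Pd] stays: by [missed_lines_bound] at least two lines off
    [P] meet [Pd] in [R] alone, and [z] is on at most one of them. If a line [m] is dropped, it
    contains [z] and [q - 1] points of [Pd]; the other [q] lines through [z] add [q] more. *)
Lemma pencil_add_point z (Pd2 : {set Pt}) (Ld2 : {set Ln}) :
    #|Pd| <= 2 * q - 3 ->
    z \notin Pd -> Pd2 \subset z |: Pd -> Ld2 \subset pen P -> dom inc Pd2 Ld2 ->
  #|Pd| + #|pen P| <= #|Pd2| + #|Ld2|.
Proof.
move=> small nz sP sL [domP domL].
have blk2 : blocks_off P Pd2.
  by move=> L nPL; apply: domL; apply: contra (subsetP sL L) _; rewrite inE.
have [sL' | /subsetPn[m]] := boolP (pen P \subset Ld2).
  apply: leq_add; last exact: subset_leq_card.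
  apply/subset_leq_card/subsetP=> R PdR; have neRz : R != z by apply: contraNneq nz => <-.
  have [L nPL [RL uR]] := pencil_essential PdR.
  pose U := [set M | [disjoint P |: (Pd :\ R) & pts M]].
  have U_L : L \in U.
    rewrite inE; apply/missedP=> X; rewrite !inE => /orP[/eqP->//|/andP[neXR PdX]].
    by apply: contraNN neXR => XL; rewrite (uR X PdX XL).
  have bdU : 2 * q <= #|P |: (Pd :\ R)| + #|U|.
    by apply: (missed_lines_bound pl co); apply/set0Pn; exists L.
  have onR M : M \in U -> ~~ inc P M /\ inc R M.
    rewrite inE => /missedP miss; have nPM := miss P (setU11 _ _); split=> //.
    have [X PdX XM] := pencil_blocks_off nPM; have [<-//|neXR] := eqVneq X R.
    by have := miss X; rewrite !inE neXR PdX orbT XM => /(_ isT).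
  have : 1 < #|U|.
    have := (leq_card_setU [set P] (Pd :\ R)).1; rewrite cards1.
    have := cardsD1 R Pd; rewrite PdR; move: bdU small; lia.
  case/card_gt1P=> M1 [M2 [U1 U2 neM]].
  have [M UM nzM] : exists2 M, M \in U & ~~ inc z M.
    have [zM1|] := boolP (inc z M1); last by exists M1.
    exists M2 => //; apply/negP=> zM2; case/eqP: neRz.
    by apply: (meet_uniq pl neM (onR _ U1).2 zM1 (onR _ U2).2 zM2).
  have [nPM RM] := onR M UM; have [X X2 XM] := blk2 M nPM.
  have := subsetP sP X X2; rewrite !inE => /orP[/eqP eX|PdX].
    by rewrite -eX XM in nzM.
  have [<-//|neXR] := eqVneq X R; move: UM; rewrite inE => /missedP/(_ X).
  by rewrite !inE neXR PdX orbT XM => /(_ isT).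
rewrite inE => Pm nm; exfalso.
have sm : pts m :\ P \subset z |: Pd.
  apply/subsetP=> R; rewrite !inE => /andP[neRP Rm].
  have [R2|nR] := boolP (R \in Pd2); first by have := subsetP sP R R2; rewrite !inE.
  have [L L2 RL] := domP R nR; have := subsetP sL L L2; rewrite inE => PL.
  by rewrite -(plane_uniq pl neRP RL PL Rm Pm) L2 in nm.
have zm : z \in pts m :\ P.
  apply/negPn/negP=> nzm; case/negP: (pencil_line_sub Pm); apply/subsetP=> R mR.
  have := subsetP sm R mR; rewrite !inE => /orP[/eqP eR|//].
  by rewrite -eR mR in nzm.
have := sum_secant_pencil pl nz; move: zm; rewrite !inE => /andP[nezP zm].
rewrite (bigD1 m) ?inE //= => eqPd.
have le_m : q.-1 <= secant Pd m.
  have := plane_line pl m; rewrite (cardsD1 P) (cardsD1 z (_ :\ _)) inE Pm.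
  rewrite !inE nezP zm /= => -[<-] /=; apply/subset_leq_card/subsetP=> R.
  rewrite !inE => /and3P[neRz neRP Rm]; have := subsetP sm R.
  by rewrite !inE neRP Rm (negPf neRz) /= => /(_ isT) ->.
have : \sum_(L in pen z | L != m) 1 <= \sum_(L in pen z | L != m) secant Pd L.
  apply: leq_sum => L; rewrite inE => /andP[zL neLm].
  have nPL : ~~ inc P L.
    by apply: contraNN neLm => PL; apply/eqP; apply: (plane_uniq pl nezP zL PL zm Pm).
  have [R PdR RL] := pencil_blocks_off nPL.
  by apply/card_gt0P; exists R; rewrite !inE PdR.
rewrite sum1_card; have -> : #|[pred L in pen z | L != m]| = q.
  have := plane_pencil pl z; rewrite (cardsD1 m) inE zm add1n => -[<-].
  by apply: eq_card => L; rewrite !inE andbC.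
by move: eqPd le_m small; lia.
Qed.

Lemma pencil_stable : #|Pd| <= 2 * q - 3 -> ~ destabilized inc Pd (pen P).
Proof.
move=> small; apply: not_destabilized => z Pd2 Ld2.
  exact: pencil_add_point.
exact: pencil_add_line.
Qed.
End Pencil.

Theorem primal_pencil Pd Ld P :
    min_dom inc Pd Ld -> q <= #|Ld :&: pen P| ->
  [\/ 3 * q - 1 <= #|Pd| + #|Ld|,
      exists2 l, inc P l & Pd = pts l :\ P /\ Ld = pen P :\ l |
      Ld = pen P].
Proof.
move=> minD le_q; have [[domP domL] min'] := minD.
have off_pen L : L \in [set L | [disjoint P |: Pd & pts L]] -> L \in Ld :\: pen P.
  rewrite !inE => /missedP miss; rewrite (miss P (setU11 _ _)) /=.
  apply/negPn/negP=> /domL[R PdR RL]; have := miss R.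
  by rewrite !inE PdR orbT RL => /(_ isT).
have le_miss := subset_leq_card (introT subsetP off_pen).
have cardPPd : #|P |: Pd| <= #|Pd|.+1.
  by have := (leq_card_setU [set P] Pd).1; rewrite cards1.
have cardL := cardsID (pen P) Ld; have cpen := plane_pencil pl P.
have [sPL | /subsetPn[l]] := boolP (pen P \subset Ld).
  have [X0 | nzX] := eqVneq (Ld :\: pen P) set0.
    by apply: Or33; apply/eqP; rewrite eqEsubset sPL andbT -setD_eq0 X0.
  apply: Or31; have [bd | blk] := missed_bound (P |: Pd).
    rewrite setIC (setIidPl sPL) cpen in cardL.
    by move: bd le_miss cardPPd cardL; lia.
  case/set0Pn: nzX => L; rewrite !inE => /andP[nPL LdL].
  have dS : dom inc Pd (Ld :\ L).
    split=> [R _ | M].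
      have [M /andP[PM RM]] := plane_join pl P R; exists M => //; rewrite !inE.
      rewrite (subsetP sPL) ?inE // andbT; by apply: contraNneq nPL => <-.
    have [-> _ | neML] := eqVneq M L; first exact: (blocks_offW blk nPL).
    by rewrite !inE neML /=; apply: domL.
  have [_ /setP/(_ L)] := min' _ _ (subxx _) (subsetDl _ _) dS.
  by rewrite !inE eqxx LdL.
rewrite inE => Pl nl; have LdP : Ld :&: pen P = pen P :\ l.
  apply/eqP; rewrite eqEcard; apply/andP; split.
    apply/subsetP=> L; rewrite !inE => /andP[LdL ->]; rewrite andbT.
    by apply: contraNneq nl => <-.
  by apply: leq_trans le_q; rewrite -ltnS -cpen [X in _ <= X](cardsD1 l) inE Pl.
have cardLP : #|Ld :&: pen P| = q.
  by rewrite LdP; move: cpen; rewrite (cardsD1 l) inE Pl add1n => -[].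
have [bd | blk] := missed_bound (P |: Pd).
  by apply: Or31; move: bd le_miss cardPPd cardL; rewrite cardLP; lia.
have [sl | /subsetPn[R]] := boolP (pts l :\ P \subset Pd).
  apply: Or32; exists l => //; have dS := dom_star (subxx (pts l :\ P)).
  have sL : pen P :\ l \subset Ld by rewrite -LdP subsetIl.
  by have [-> ->] := min' _ _ sl sL dS.
rewrite !inE => /andP[neRP Rl] nR; apply: Or31.
(* Distinct points of [W] need distinct lines of [Ld] off [P], while counting [Pd] from [R] gives at
   least [(q - |W|) + q] points. In the total size [|W|] cancels. *)
pose W := (pts l :\ P) :\: Pd.
have le_W : #|W| <= #|Ld :\: pen P|.
  pose g L := odflt P [pick X | inc X l && inc X L].
  apply: leq_trans (leq_imset_card g _); apply/subset_leq_card/subsetP=> X.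
  rewrite !inE => /and3P[nX neXP Xl]; have [L LdL XL] := domP X nX.
  have nelL : l != L by apply: contraNneq nl => ->.
  have nPL : ~~ inc P L.
    by apply: contraNN neXP => PL; rewrite (meet_uniq pl nelL Xl Pl XL PL).
  apply/imsetP; exists L; first by rewrite !inE nPL.
  rewrite /g; case: pickP => [Y /andP[Yl YL] | /(_ X)]; last by rewrite Xl XL.
  exact: (meet_uniq pl nelL Xl Yl XL YL).
have le_Pd : q - #|W| + q <= #|Pd|.
  rewrite -(sum_secant_pencil pl nR) (bigD1 l) ?inE //=; apply: leq_add.
    have := plane_line pl l; rewrite (cardsD1 P) inE Pl add1n => -[<-].
    rewrite leq_subLR addnC -(cardsID Pd) leq_add2r; apply/subset_leq_card/subsetP=> X.
    by rewrite !inE => /andP[/andP[_ ->] ->].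
  have -> : q = \sum_(L in pen R | L != l) 1.
    rewrite sum1_card; have := plane_pencil pl R; rewrite (cardsD1 l) inE Rl add1n => -[<-].
    by apply: eq_card => L; rewrite [RHS]unfold_in !inE andbC.
  apply: leq_sum => L; rewrite inE => /andP[RL neLl].
  have nPL : ~~ inc P L.
    by apply: contraNN neLl => PL; apply/eqP; apply: (plane_uniq pl neRP RL PL Rl Pl).
  have [X PdX XL] := blocks_offW blk nPL.
  by apply/card_gt0P; exists X; rewrite !inE PdX.
by move: le_W le_Pd cardL; rewrite cardLP; lia.
Qed.
End Primal.

Theorem star_stable (F : finFieldType) (Pt Ln : finType) (inc : Pt -> Ln -> bool) P l :
  plane #|F| inc -> 2 < #|F| -> inc P l ->
  ~ destabilized inc (points_on inc l :\ P) (lines_through inc P :\ l).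
Proof.
move=> pl q_gt2 Pl; apply: not_destabilized => z Pd2 Ld2 nz sP sL dom2.
  rewrite [leqLHS]addnC [leqRHS]addnC.
  exact: (star_add_line (plane_dual pl) q_gt2 Pl nz sL sP (dom_dual dom2)).
exact: (star_add_line pl q_gt2 Pl nz sP sL dom2).
Qed.

(** * Coordinates in PG(2,q) *)

Lemma ord3_cases (i : 'I_3) : [\/ i = 0, i = 1 | i = 2%:R]%R.
Proof.
by case: i => -[|[|[|//]]] lt_i; [apply: Or31|apply: Or32|apply: Or33]; apply: val_inj.
Qed.

Lemma dot3E (F : fieldType) (y z : 'rV[F]_3) :
  (y *m z^T = (y 0 0 * z 0 0 + y 0 1 * z 0 1 + y 0 2%:R * z 0 2%:R)%:M)%R.
Proof.
apply/matrixP=> i j; rewrite !mxE !big_ord_recl big_ord0 addr0 addrA !mxE !ord1 mulr1n.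
by congr (y 0 _ * z 0 _ + y 0 _ * z 0 _ + y 0 _ * z 0 _)%R; apply: val_inj.
Qed.

Lemma scalar1_eq0 (F : fieldType) (c : F) : (c%:M == 0 :> 'M_1)%R = (c == 0)%R.
Proof.
apply/eqP/eqP=> [/matrixP/(_ 0 0)%R | ->]; last by rewrite raddf0.
by rewrite !mxE eqxx mulr1n.
Qed.

Section VectorModel.
Variable F : finFieldType.
Local Open Scope ring_scope.

(** Vectors matter up to scalars, hence inclusions of row spaces in place of equalities. The
    symmetry between [u] and [w] gives the dual plane its coordinates. *)
Record homogeneous (Pt Ln : finType) (inc : Pt -> Ln -> bool)
    (u : Pt -> 'rV[F]_3) (w : Ln -> 'rV[F]_3) : Prop := Homogeneous {
  hom_inc : forall P L, inc P L = (u P *m (w L)^T == 0);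
  hom_pt_neq0 : forall P, u P != 0;
  hom_ln_neq0 : forall L, w L != 0;
  hom_pt : forall v : 'rV[F]_3, v != 0 -> exists P, (u P <= v)%MS;
  hom_ln : forall v : 'rV[F]_3, v != 0 -> exists L, (w L <= v)%MS;
  hom_pt_inj : forall P R, (u P <= u R)%MS -> P = R;
  hom_ln_inj : forall L M, (w L <= w M)%MS -> L = M
}.

Lemma homogeneous_dual Pt Ln inc u w :
  @homogeneous Pt Ln inc u w -> homogeneous (fun L P => inc P L) w u.
Proof.
case=> i n1 n2 s1 s2 j1 j2; split=> // L P.
by rewrite i -trmx_eq0 trmx_mul trmxK.
Qed.

Section Homogeneous.
Variables (Pt Ln : finType) (inc : Pt -> Ln -> bool).
Variables (u : Pt -> 'rV[F]_3) (w : Ln -> 'rV[F]_3).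
Hypothesis hom : homogeneous inc u w.

Lemma rank1_sub m (v : 'rV[F]_3) (K : 'M[F]_(m, 3)) :
  v != 0 -> (v <= K)%MS -> (\rank K <= 1)%N -> (K <= v)%MS.
Proof.
move=> nzv vK rK; rewrite -(mxrank_leqif_sup vK) eqn_leq mxrankS //=.
by rewrite rank_rV nzv.
Qed.

Lemma scaled_line (v : 'rV[F]_3) L : (w L <= v)%MS -> forall P, inc P L = (u P *m v^T == 0).
Proof.
case/sub_rVP=> c eL P; rewrite (hom_inc hom) eL linearZ /= -scalemxAr.
have nz : c != 0 by apply: contraNneq (hom_ln_neq0 hom L); rewrite eL => ->; rewrite scale0r.
by rewrite scalemx_eq0 (negPf nz).
Qed.

Lemma hom_join P R : exists L, inc P L && inc R L.
Proof.
pose A := col_mx (u P) (u R); have nzK : kermx A^T != 0.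
  rewrite kermx_eq0 /row_free mxrank_tr neq_ltn; apply/orP; left.
  by apply: leq_ltn_trans (rank_leq_row A) _.
have nzv : nz_row (kermx A^T) != 0 by rewrite nz_row_eq0.
have [L wL] := hom_ln hom nzv; exists L; rewrite !(scaled_line wL).
have : nz_row (kermx A^T) *m A^T = 0 by apply/sub_kermxP/nz_row_sub.
move/(congr1 trmx); rewrite trmx_mul trmxK trmx0 mul_col_mx => /eqP.
by rewrite col_mx_eq0.
Qed.

Lemma hom_uniq P R L M : P != R -> inc P L -> inc R L -> inc P M -> inc R M -> L = M.
Proof.
move=> nePR; pose A := col_mx (u P) (u R).
have rA : (1 < \rank A)%N.
  rewrite ltnNge; apply: contraNN nePR => rA; apply/eqP/(hom_pt_inj hom).
  have sub_A : (u P <= A)%MS /\ (u R <= A)%MS.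
    by rewrite -!addsmxE addsmxSl addsmxSr.
  by apply: submx_trans sub_A.1 (rank1_sub (hom_pt_neq0 hom R) sub_A.2 rA).
have on N : inc P N -> inc R N -> (w N <= kermx A^T)%MS.
  rewrite !(hom_inc hom) => /eqP PN /eqP RN; apply/sub_kermxP.
  by apply: trmx_inj; rewrite trmx_mul trmxK trmx0 mul_col_mx PN RN col_mx0.
have rK : (\rank (kermx A^T) <= 1)%N by rewrite mxrank_ker mxrank_tr; lia.
move=> PL RL PM RM; apply/(hom_ln_inj hom); apply: submx_trans (on L PL RL) _.
exact: rank1_sub (hom_ln_neq0 hom M) (on M PM RM) rK.
Qed.

Lemma vec_off (v e : 'rV[F]_3) : exists2 x : 'rV[F]_3, x *m v^T = 0 & ~~ (x <= e)%MS.
Proof.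
have : ~~ (kermx v^T <= e)%MS.
  apply/negP=> /mxrankS; rewrite mxrank_ker mxrank_tr !rank_rV.
  by case: (v != 0); case: (e != 0).
case/row_subPn=> i nx; exists (row i (kermx v^T)) => //.
by rewrite -row_mul mulmx_ker row0.
Qed.

Lemma hom_other_point P l : exists R, R != P /\ inc R l.
Proof.
have [x xl nx] := vec_off (w l) (u P).
have nzx : x != 0 by apply: contraNneq nx => ->; rewrite sub0mx.
have [R Rx] := hom_pt hom nzx; exists R; split.
  apply: contraNneq nx => eR; rewrite -eR; apply: rank1_sub (hom_pt_neq0 hom R) Rx _.
    by rewrite rank_rV; case: (x != 0).
by rewrite (hom_inc hom); case/sub_rVP: Rx => c ->; rewrite -scalemxAl xl scaler0.
Qed.

(** In a basis [u P], [e1], [e2] with [e1] on [l] and [e2] off it, [l] is [x2 = 0], and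
    [a = x1 / x2], [b = x0 / x2]. Lines off [P] have a nonzero [x0] coefficient, normalized to [1];
    the lines through [P] used here are [x1 = c x2]. *)
Lemma hom_coordinates : coordinatized F inc.
Proof.
move=> P l Pl; have [e1 e1l ne1] := vec_off (w l) (u P).
have [e2 ne2] : exists e2 : 'rV[F]_3, e2 *m (w l)^T != 0.
  have /rV0Pn[i wi] := hom_ln_neq0 hom l; exists (delta_mx 0 i).
  by apply: contraNneq wi => /matrixP/(_ 0 0); rewrite -rowE !mxE => ->.
have e0l : u P *m (w l)^T = 0 by apply/eqP; rewrite -(hom_inc hom).
pose e := fun i : 'I_3 => if i == 0 then u P else if i == 1 then e1 else e2.
pose E : 'M[F]_3 := \matrix_(i, j) e i 0 j.
have mulE (v : 'rV[F]_3) : v *m E = v 0 0 *: u P + v 0 1 *: e1 + v 0 2%:R *: e2.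
  apply/rowP=> j; rewrite !mxE !big_ord_recl big_ord0 addr0 addrA !mxE /e /=.
  by congr (_ * _ + v 0 _ * _ + v 0 _ * _); apply: val_inj.
have unitE : E \in unitmx.
  rewrite -row_free_unit; apply: inj_row_free => v; rewrite mulE => v0.
  have v2 : v 0 2%:R = 0.
    move/(congr1 (fun x => x *m (w l)^T)): (v0); rewrite !mulmxDl -!scalemxAl e0l e1l.
    by rewrite !scaler0 !add0r mul0mx => /eqP; rewrite scalemx_eq0 (negPf ne2) orbF => /eqP.
  rewrite v2 scale0r addr0 in v0.
  have v1 : v 0 1 = 0.
    apply/eqP; apply: contraNT ne1 => nz; apply/sub_rVP.
    exists (- (v 0 1)^-1 * v 0 0); apply/eqP.
    rewrite -(subr_eq0) mulNr scaleNr opprK -scalerA.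
    by rewrite -[e1 in X in X + _]scale1r -(mulVf nz) -scalerA -scalerDr addrC v0 scaler0.
  rewrite v1 scale0r addr0 in v0; move/eqP: v0.
  rewrite scalemx_eq0 (negPf (hom_pt_neq0 hom P)) orbF => /eqP v00.
  apply/rowP=> i; rewrite [RHS]mxE; case: (ord3_cases i) => -> //.
pose x R := u R *m invmx E.
have xE R : u R = x R 0 0 *: u P + x R 0 1 *: e1 + x R 0 2%:R *: e2.
  by rewrite -mulE mulmxKV.
have offl R : inc R l = (x R 0 2%:R == 0).
  rewrite (hom_inc hom) (xE R) !mulmxDl -!scalemxAl e0l e1l !scaler0 !add0r.
  by rewrite scalemx_eq0 (negPf ne2) orbF.
have functional (f0 f1 f2 : F) : (f0 != 0) || (f1 != 0) ->
    exists L, [/\ inc P L = (f0 == 0), (f0 == 0) -> L != l &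
      forall R, inc R L = (x R 0 0 * f0 + x R 0 1 * f1 + x R 0 2%:R * f2 == 0)].
  move=> nzf; pose f : 'rV[F]_3 := \row_i (if i == 0 then f0 else if i == 1 then f1 else f2).
  pose v := f *m (invmx E)^T.
  have vE y : y *m v^T = (y *m invmx E) *m f^T by rewrite /v trmx_mul trmxK mulmxA.
  have fE R : (u R *m v^T == 0) = (x R 0 0 * f0 + x R 0 1 * f1 + x R 0 2%:R * f2 == 0).
    by rewrite vE dot3E scalar1_eq0 !mxE /=.
  have nzv : v != 0.
    rewrite mulmx_free_eq0 ?row_free_unit ?unitmx_tr ?unitmx_inv //.
    by apply: contraTneq nzf => /rowP f_0; rewrite -negb_and negbK;
      have := f_0 0; have := f_0 1; rewrite !mxE /= => -> ->; rewrite eqxx.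
  have [L wL] := hom_ln hom nzv; have LE R := scaled_line wL R.
  have xP : x P = delta_mx 0 0.
    rewrite /x -[u P](_ : delta_mx 0 0 *m E = u P) ?mulmxK // mulE !mxE /=.
    by rewrite scale1r !scale0r !addr0.
  exists L; split=> [|/eqP f0_0|R]; [| | by rewrite LE fE].
    by rewrite LE fE xP !mxE /= mul1r !mul0r !addr0.
  have nz1 : f1 != 0 by move: nzf; rewrite f0_0 eqxx.
  have ve1 : e1 *m v^T = f1%:M.
    have -> : e1 = delta_mx 0 1 *m E by rewrite mulE !mxE /= scale1r !scale0r add0r addr0.
    by rewrite vE mulmxK // dot3E !mxE /= !mul0r mul1r add0r addr0.
  case/sub_rVP: wL => c eL; apply/eqP=> eLl; move/eqP: e1l.
  rewrite -eLl eL linearZ /= -scalemxAr ve1 scale_scalar_mx scalar1_eq0 /=.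
  rewrite mulf_eq0 (negPf nz1) orbF => /eqP c0.
  by have := hom_ln_neq0 hom L; rewrite eL c0 scale0r eqxx.
pose a R := x R 0 1 / x R 0 2%:R; pose b R := x R 0 0 / x R 0 2%:R.
exists a, b; split=> [y z | c].
  have [|L [PL _ LE]] := functional 1 z y; first by rewrite oner_eq0.
  exists L; first by rewrite PL oner_eq0.
  move=> R; rewrite offl LE /a /b => nz.
  have -> : y + (x R 0 1 / x R 0 2%:R * z + x R 0 0 / x R 0 2%:R) =
      (x R 0 0 * 1 + x R 0 1 * z + x R 0 2%:R * y) / x R 0 2%:R by field.
  by rewrite mulf_eq0 invr_eq0 (negPf nz) orbF.
have [|L [PL neL LE]] := functional 0 1 (- c); first by rewrite oner_eq0 orbT.
exists L; first by rewrite PL eqxx neL.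
move=> R; rewrite offl LE /a => nz.
by rewrite mulr0 add0r mulr1 mulrN subr_eq0 -[RHS](inj_eq (mulIf nz)) divfK // mulrC.
Qed.

Lemma hom_card_pencil P : #|[set L | inc P L]| = #|F|.+1.
Proof.
have [l /andP[Pl _]] := hom_join P P; have [a [b [_ ca]]] := hom_coordinates Pl.
have ca' c : exists L, (inc P L && (L != l)) && [forall R, ~~ inc R l ==> (inc R L == (a R == c))].
  have [L PL LE] := ca c; exists L; rewrite PL; apply/forallP=> R; apply/implyP=> nR.
  by rewrite LE.
pose g c := xchoose (ca' c).
have gE c : [/\ inc P (g c), g c != l & forall R, ~~ inc R l -> inc R (g c) = (a R == c)].
  have /andP[/andP[Pg gl] /forallP gR] := xchooseP (ca' c).
  by split=> // R nR; have := gR R; rewrite nR => /eqP.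
have off L R : inc P L -> L != l -> R != P -> inc R L -> ~~ inc R l.
  move=> PL neL neRP RL; apply: contraNN neL => Rl; apply/eqP.
  exact: hom_uniq neRP RL PL Rl Pl.
have inj_g : injective g.
  move=> c c' eg; have [Pg gl gR] := gE c; have [_ _ gR'] := gE c'.
  have [R [neR Rg]] := hom_other_point P (g c).
  have nR := off _ _ Pg gl neR Rg; have := Rg; rewrite gR // => /eqP<-.
  by have := Rg; rewrite eg gR' // => /eqP<-.
rewrite (cardsD1 l) inE Pl add1n; congr _.+1; rewrite -(card_image inj_g).
apply: eq_card => L; rewrite !inE; apply/andP/imageP=> [[neL PL] | [c _ ->]].
  have [R [neR RL]] := hom_other_point P L; exists (a R) => //.
  have [Pg gl gR] := gE (a R); apply: (hom_uniq neR RL PL _ Pg).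
  by rewrite gR ?eqxx // (off L R PL neL neR RL).
by have [] := gE c.
Qed.
End Homogeneous.
End VectorModel.

Theorem homogeneous_plane (F : finFieldType) (Pt Ln : finType) (inc : Pt -> Ln -> bool)
    (u : Pt -> 'rV[F]_3) (w : Ln -> 'rV[F]_3) :
  homogeneous inc u w -> plane #|F| inc /\ coordinatized F inc.
Proof.
move=> hom; have homd := homogeneous_dual hom; split; last exact: hom_coordinates hom.
split; [exact: hom_join hom | exact: hom_join homd | exact: hom_uniq hom | |].
  exact: hom_card_pencil homd.
exact: hom_card_pencil hom.
Qed.

Section PG.
Variable F : finFieldType.
Local Open Scope ring_scope.

Definition point_vec (P : point F) : 'rV[F]_3 := nz_row (val P).
Definition line_vec (L : line F) : 'rV[F]_3 := nz_row (kermx (val L)^T).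

Lemma point_vecE (P : point F) : (point_vec P :=: val P)%MS /\ point_vec P != 0.
Proof.
have /andP[/eqP rP _] := valP P.
have nz : point_vec P != 0 by rewrite nz_row_eq0 -mxrank_eq0 rP.
split=> //; apply/eqmxP; rewrite nz_row_sub /=.
by apply: rank1_sub nz (nz_row_sub _) _; rewrite rP.
Qed.

Lemma line_vecE (L : line F) : (line_vec L :=: kermx (val L)^T)%MS /\ line_vec L != 0.
Proof.
have /andP[/eqP rL _] := valP L.
have rK : \rank (kermx (val L)^T) = 1%N by rewrite mxrank_ker mxrank_tr rL.
have nz : line_vec L != 0 by rewrite nz_row_eq0 -mxrank_eq0 rK.
split=> //; apply/eqmxP; rewrite nz_row_sub /=.
by apply: rank1_sub nz (nz_row_sub _) _; rewrite rK.
Qed.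

Lemma line_kermx (L : line F) : (val L :=: kermx (line_vec L)^T)%MS.
Proof.
have /andP[/eqP rL _] := valP L; have [_ nz] := line_vecE L.
have sub : (val L <= kermx (line_vec L)^T)%MS.
  apply/sub_kermxP/trmx_inj; rewrite trmx_mul trmxK trmx0.
  by apply/sub_kermxP; apply: nz_row_sub.
apply/eqmxP; rewrite sub -(mxrank_leqif_sup sub).2 rL mxrank_ker mxrank_tr.
by rewrite rank_rV nz.
Qed.

Lemma homogeneous_PG : homogeneous (@inc F) point_vec line_vec.
Proof.
split.
- move=> P L; rewrite /inc -(point_vecE P).1 line_kermx.
  by apply/sub_kermxP/eqP.
- by move=> P; have [] := point_vecE P.
- by move=> L; have [] := line_vecE L.
- move=> v nzv; have isP : is_pt <<v>>%MS by rewrite /is_pt genmxE rank_rV nzv genmx_id eqxx.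
  by exists (Sub _ isP : point F); rewrite (point_vecE _).1 genmxE.
- move=> v nzv; pose K := <<kermx v^T>>%MS.
  have isL : is_ln K by rewrite /is_ln /K genmx_id genmxE mxrank_ker mxrank_tr rank_rV nzv eqxx.
  exists (Sub _ isL : line F); rewrite (line_vecE _).1 /=; apply: (rank1_sub nzv).
    apply/sub_kermxP/trmx_inj; rewrite trmx_mul trmxK trmx0.
    by apply/sub_kermxP; rewrite genmxE.
  by rewrite mxrank_ker mxrank_tr genmxE mxrank_ker mxrank_tr rank_rV nzv.
- move=> P R sPR; have /andP[/eqP rP /eqP gP] := valP P; have /andP[/eqP rR /eqP gR] := valP R.
  apply: val_inj; rewrite /= -gP -gR; apply: eq_genmx; apply/eqmxP.
  have sub : (val P <= val R)%MS by rewrite -(point_vecE P).1 -(point_vecE R).1.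
  by rewrite sub -(mxrank_leqif_sup sub).2 rP rR.
- move=> L M sLM; have /andP[/eqP rL /eqP gL] := valP L; have /andP[/eqP rM /eqP gM] := valP M.
  apply: val_inj; rewrite /= -gL -gM; apply: eq_genmx; apply/eqmxP.
  have sub : (val M <= val L)%MS.
    rewrite !line_kermx; apply/sub_kermxP; case/sub_rVP: sLM => c ->.
    by rewrite linearZ /= -scalemxAr mulmx_ker scaler0.
  by rewrite sub -(mxrank_leqif_sup sub).2 rL rM.
Qed.
End PG.

(** * The classification *)

Section Classification.
Variables (F : finFieldType) (Pt Ln : finType) (inc : Pt -> Ln -> bool).
Hypothesis pl : plane #|F| inc.
Hypothesis co : coordinatized F inc.
Variables (p n : nat).
Hypotheses (pr_p : prime p) (cardF : #|F| = p ^ n) (gt16 : 16 < #|F|).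
Implicit Types (P R X : Pt) (L M l m : Ln) (B S : {set Pt}) (T : {set Ln}).
Local Notation pts := (points_on inc).
Local Notation pen := (lines_through inc).
Local Notation q := #|F|.

Definition min_nontrivial B : Prop :=
  [/\ blocks inc B, forall L, ~~ (pts L \subset B) &
      forall B' : {set Pt}, B' \proper B -> ~ blocks inc B'].

Definition baer S : Prop := exists Q T,
  [/\ q = Q * Q, subplane inc S T Q & subplane (fun L P => inc P L) T S Q].

Lemma minimal_tangent B P : (forall B' : {set Pt}, B' \proper B -> ~ blocks inc B') ->
  P \in B -> blocks inc B -> exists2 L, inc P L & forall R, R \in B -> inc R L -> R = P.
Proof.
move=> minB BP blk; have [blkP | ] := boolP [forall L, ~~ [disjoint B :\ P & pts L]].
  case: (minB _ (properD1 BP)) => L; have /pred0Pn[R /andP[BR]] := forallP blkP L.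
  by rewrite /= inE => RL; exists R.
case/forallPn=> L; rewrite negbK => /missedP miss.
have uP R : R \in B -> inc R L -> R = P.
  move=> BR RL; apply/eqP; apply: contraTT RL => neRP.
  by apply: miss; rewrite !inE neRP.
by exists L => //; have [R BR RL] := blk L; rewrite -(uP R BR RL).
Qed.

Lemma card_blocking B L : blocks inc B -> ~~ (pts L \subset B) -> q < #|B|.
Proof.
move=> blk /subsetPn[R _ nR]; rewrite -(sum_secant_pencil pl nR).
rewrite -(plane_pencil pl R) -sum1_card; apply: leq_sum => M _.
by have [X BX XM] := blk M; apply/card_gt0P; exists X; rewrite !inE BX.
Qed.

Lemma small_blocking B k : min_nontrivial B -> #|B| = (q + k).+1 ->
  below_two_thirds p q k -> q = k * k /\ baer B.
Proof.
case=> blk nfull minB cardB small_k.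
have tanB P BP := minimal_tangent minB (P := P) BP blk.
have [Q [qE kE secB]] := small_blocking_secants pl co pr_p cardF gt16 small_k blk tanB nfull cardB.
rewrite kE in cardB *; split=> //; exists Q, [set L | secant_size inc B L == Q.+1].
have Q_gt1 : 1 < Q by rewrite ltnNge; apply/negP=> leQ1; move: gt16; rewrite qE; nia.
by have [] := baer_of_secants pl Q_gt1 qE cardB secB.
Qed.

Inductive primal_type Pd Ld P : Prop :=
| PrimalStar l of inc P l & Pd = pts l :\ P & Ld = pen P :\ l
| PrimalLine l of ~~ inc P l & Pd = pts l & Ld = pen P
| PrimalBaerMinus k of q = k * k & baer (P |: Pd) & P \notin Pd & Ld = pen P &
    #|Pd| + #|Ld| = 2 * q + k + 1
| PrimalBaer k B of q = k * k & baer Pd & P \notin Pd & Ld = pen P &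
    #|Pd| + #|Ld| = 2 * q + k + 2 &
    [/\ min_nontrivial B, Pd \subset B & #|B :\: Pd| <= 1]
| PrimalLarge k B of ~~ below_two_thirds p q k & Ld = pen P &
    #|Pd| + #|Ld| = 2 * q + 1 + k &
    [/\ min_nontrivial B, Pd \subset B & #|B :\: Pd| <= 1].

Theorem primal_classification Pd Ld P :
    min_dom inc Pd Ld -> q <= #|Ld :&: pen P| -> #|Pd| + #|Ld| < 3 * q - 1 ->
  primal_type Pd Ld P /\ ~ destabilized inc Pd Ld.
Proof.
move=> minD le_q lt_s; have q_gt2 : 2 < q by apply: leq_trans gt16.
have [|[l Pl [eP eL]]|eL] := primal_pencil pl co q_gt2 minD le_q.
- by rewrite leqNgt lt_s.
- split; first exact: PrimalStar Pl eP eL.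
  by rewrite eP eL; exact: star_stable pl q_gt2 Pl.
rewrite eL in minD lt_s *; have cpen := plane_pencil pl P.
have small : #|Pd| <= 2 * q - 3 by move: lt_s; rewrite cpen; lia.
split; last exact: (pencil_stable pl co q_gt2 minD small).
have nP := pencil_center pl minD.
have [[l nPl ePd] | [B [blk nfull minB sPdB sBP]]] := pencil_shape pl q_gt2 minD.
  exact: PrimalLine nPl ePd (erefl _).
have minnB : min_nontrivial B by [].
have [L _] : exists L, L \in pen P by apply/card_gt0P; rewrite cpen.
have [k cardB] : exists k, #|B| = (q + k).+1.
  by exists (#|B| - q.+1); rewrite -addSn subnKC // (card_blocking blk (nfull L)).
have cardBD : #|B :\: Pd| <= 1.
  rewrite -(cards1 P); apply/subset_leq_card/subsetP=> X.
  rewrite !inE => /andP[nX BX]; have := subsetP sBP X BX.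
  by rewrite !inE (negPf nX) orbF.
have [BP | nBP] := boolP (P \in B).
  have eB : B = P |: Pd by apply/eqP; rewrite eqEsubset sBP subUset sub1set BP.
  have cB : #|B| = #|Pd|.+1 by rewrite eB cardsU1 nP.
  have cs : #|Pd| + #|pen P| = 2 * q + k + 1 by rewrite cpen; lia.
  have [small_k | large_k] := boolP (below_two_thirds p q k).
    have [qE bB] := small_blocking minnB cardB small_k.
    by apply: (PrimalBaerMinus qE _ nP) => //; rewrite -eB.
  by apply: (PrimalLarge large_k (erefl _) (B := B)) => //; rewrite cs addnAC.
have eB : B = Pd.
  apply/eqP; rewrite eqEsubset sPdB andbT; apply/subsetP=> X BX.
  have := subsetP sBP X BX; rewrite !inE => /orP[/eqP eX|//].
  by rewrite -eX BX in nBP.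
have cs : #|Pd| + #|pen P| = 2 * q + k + 2 by rewrite cpen -eB cardB; lia.
have [small_k | large_k] := boolP (below_two_thirds p q k).
  have [qE bB] := small_blocking minnB cardB small_k.
  by apply: (PrimalBaer qE _ nP (erefl _) cs (B := B)) => //; rewrite -eB.
(* With [P] outside [B] the size grows by one, so the excess over [2 q + 1] is [k + 1], which is not
   small because [k] is not. *)
apply: (PrimalLarge (k := k.+1) (B := B)) => //; last by rewrite cs; lia.
apply: contra large_k => /andP[lt1 /implyP lt2].
have le3 : k ^ 3 <= k.+1 ^ 3 by rewrite leq_exp2r.
apply/andP; split; first exact: leq_ltn_trans lt1.
by apply/implyP=> /lt2; apply: leq_ltn_trans; rewrite leq_mul2l le3.
Qed.
End Classification.

Lemma not_below_two_thirds p q k : ~~ below_two_thirds p q k ->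
  q ^ 2 <= 2 * k ^ 3 /\ (3 < p -> q ^ 2 <= k ^ 3).
Proof.
rewrite negb_and negb_imply -leqNgt; case: (leqP p 3) => /= _; last by rewrite orbF; lia.
by rewrite -leqNgt => /orP le; split=> //; lia.
Qed.

(** [k^2 <= q] would give [q^4 <= 4 k^6 <= 4 q^3]. Large sizes thus exceed [2 q + sqrt q + 1]. *)
Lemma not_below_two_thirds_sqr p q k : 16 < q -> ~~ below_two_thirds p q k -> q < k ^ 2.
Proof.
move=> gt16 /not_below_two_thirds[le_q _]; rewrite ltnNge; apply/negP=> le_k.
have : (k ^ 2) ^ 3 <= q ^ 3 by rewrite leq_exp2r.
have : (q ^ 2) ^ 2 <= (2 * k ^ 3) ^ 2 by rewrite leq_exp2r.
by rewrite expnMn -!expnM; nia.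
Qed.

(** This separates the size [2 q + sqrt q + 2] from the large ones, so that this size occurs only
    for Baer subplanes. *)
Lemma below_two_thirds_sqrt p Q : 4 < Q -> below_two_thirds p (Q * Q) Q.+1.
Proof.
move=> lt4Q; have lt3 : 2 * Q.+1 ^ 3 < (Q * Q) ^ 2.
  have h : 2 * (Q.+1 * Q.+1) <= 3 * (Q * Q) by nia.
  have : 2 * (Q.+1 * Q.+1) * Q.+1 <= 3 * (Q * Q) * Q.+1 by rewrite leq_mul2r h orbT.
  have : (Q * Q) * (3 * Q.+1) < (Q * Q) * (Q * Q) by rewrite ltn_mul2l; apply/andP; split; nia.
  by rewrite !expnS !expn0 !muln1; lia.
by apply/andP; split; [apply: leq_ltn_trans lt3; rewrite leq_pmull | apply/implyP].
Qed.

(** * Passage between integer and real size conditions *)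

Module RealSizes.
Import Reals Lra.
Local Open Scope R_scope.

Lemma INR_addn (m n : nat) : INR (m + n)%nat = INR m + INR n. Proof. exact: plus_INR. Qed.
Lemma INR_muln (m n : nat) : INR (m * n)%nat = INR m * INR n. Proof. exact: mult_INR. Qed.
Lemma INR_leq (m n : nat) : (m <= n)%nat -> INR m <= INR n. Proof. by move/leP/le_INR. Qed.
Lemma INR_ltn (m n : nat) : (m < n)%nat -> INR m < INR n. Proof. by move/ltP/lt_INR. Qed.

Lemma INR_size (q a k : nat) : INR (2 * q + a + k)%nat = 2 * INR q + INR a + INR k.
Proof. by rewrite (INR_addn (2 * q + a)) (INR_addn (2 * q)) (INR_muln 2) /=; lra. Qed.

Lemma size_is_sqrt (Q s k : nat) : s = (2 * (Q * Q) + Q + k)%nat ->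
  size_is_2q_sqrt_plus (Q * Q) s k.
Proof.
move=> ->; rewrite /size_is_2q_sqrt_plus INR_size INR_muln sqrt_square; last exact: pos_INR.
by lra.
Qed.

(** The equation exhibits [sqrt q] as a difference of natural numbers, so [q] is a square. *)
Lemma size_is_sqrt_inv q s k : size_is_2q_sqrt_plus q s k ->
  exists Q, q = (Q * Q)%nat /\ s = (2 * q + Q + k)%nat.
Proof.
rewrite /size_is_2q_sqrt_plus => eqs; have q_ge0 := pos_INR q.
have r_ge0 := sqrt_pos (INR q).
have le_s : (2 * q + k <= s)%nat.
  by apply/leP/INR_le; rewrite (INR_addn (2 * q)) (INR_muln 2) /=; lra.
exists (s - (2 * q + k))%nat; split; last by rewrite addnAC subnKC.
have eqs' : INR (s - (2 * q + k))%nat = sqrt (INR q).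
  have := congr1 INR (subnKC le_s); rewrite (INR_addn (2 * q + k)).
  by rewrite (INR_addn (2 * q)) (INR_muln 2) /=; lra.
by apply: INR_eq; rewrite INR_muln eqs' sqrt_sqrt.
Qed.

Lemma size_gt_sqrt q s k : s = (2 * q + 1 + k)%nat -> (q < k * k)%nat -> size_gt_2q_sqrt_1 q s.
Proof.
move=> -> lt_q; rewrite /size_gt_2q_sqrt_1 INR_size [INR 1]/=.
suff : sqrt (INR q) < INR k by lra.
rewrite -(sqrt_square (INR k)); last exact: pos_INR.
apply: sqrt_lt_1_alt; split; first exact: pos_INR.
rewrite -INR_muln; exact: INR_ltn.
Qed.

(* Taking logarithms turns [c * q ^ (2/3) <= k] into [c ^ 3 * q ^ 2 <= k ^ 3]. *)
Lemma size_ge_cp p q s k : prime p -> (0 < q)%nat -> s = (2 * q + 1 + k)%nat ->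
  (q * q <= 2 * (k * (k * k)))%nat -> (3 < p -> q * q <= k * (k * k))%nat -> size_ge_2q_cp p q s.
Proof.
move=> pr_p q_gt0 -> le2 le1; rewrite /size_ge_2q_cp INR_size [INR 1]/=.
suff : c_p p * Rpower (INR q) (2 / 3) <= INR k by lra.
have k_gt0 : (0 < k)%nat.
  by case: k le2 {le1} => //; rewrite !muln0 leqn0 muln_eq0; case: q q_gt0.
have Rq : 0 < INR q by apply: (INR_ltn q_gt0).
have Rk : 0 < INR k by apply: (INR_ltn k_gt0).
have Rkk : 0 < INR k * INR k by apply: Rmult_lt_0_compat.
have Rkkk : 0 < INR k * (INR k * INR k) by apply: Rmult_lt_0_compat.
have Rqq : 0 < INR q * INR q by apply: Rmult_lt_0_compat.
have exp_le x y : x <= y -> exp x <= exp y.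
  by case/Rle_lt_or_eq_dec => [/exp_increasing/Rlt_le | -> //]; lra.
have ln_le2 x y : 0 < x -> x <= y -> ln x <= ln y.
  by move=> Rx /Rle_lt_or_eq_dec[/(ln_increasing _ _ Rx)/Rlt_le | -> ]; lra.
rewrite -(exp_ln (INR k)) // /c_p; case: ifP => [_|np].
  rewrite /Rpower -exp_plus; apply: exp_le.
  have INR2 : INR 2 = 2 by rewrite /=; lra.
  have := INR_leq le2; rewrite (INR_muln 2) !INR_muln INR2 => /(ln_le2 _ _ Rqq).
  rewrite !ln_mult //; last by lra.
  lra.
rewrite Rmult_1_l /Rpower; apply: exp_le.
have p_gt3 : (3 < p)%nat by case: p pr_p np {le1} => [|[|[|[|]]]].
have := INR_leq (le1 p_gt3); rewrite !INR_muln => /(ln_le2 _ _ Rqq).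
by rewrite !ln_mult //; lra.
Qed.
End RealSizes.

Import RealSizes.

Lemma destabilized_dual Pt Ln inc (Pd : {set Pt}) (Ld : {set Ln}) :
  destabilized inc Pd Ld -> destabilized (fun L P => inc P L) Ld Pd.
Proof.
case=> [P1 [P2 [L1 [L2 [sP sL d1 c1 [sP2 sL2 d2 c2]]]]]].
exists L1, L2, P1, P2; split=> //; first exact: dom_dual d1.
  by rewrite addnC c1 addnC.
by split=> //; [exact: dom_dual d2 | rewrite addnC [ltnRHS]addnC].
Qed.

Section PGLemmas.
Variable F : finFieldType.
Implicit Types (Pd : {set point F}) (Ld : {set line F}).

Lemma plane_PG : plane #|F| (@inc F) /\ coordinatized F (@inc F).
Proof. exact: homogeneous_plane (homogeneous_PG F). Qed.

Lemma plane_PG_dual :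
  plane #|F| (fun L P => @inc F P L) /\ coordinatized F (fun L P => @inc F P L).
Proof. exact: homogeneous_plane (homogeneous_dual (homogeneous_PG F)). Qed.

Definition baer_outside Pd Ld : Prop :=
  (exists S T (P : point F), [/\ baer_subplane S T, P \notin S, Ld = pencil P & Pd = S]) \/
  (exists S T (l : line F), [/\ baer_subplane S T, l \notin T, Pd = ptsof l & Ld = T]).

Lemma baer_outside_size Pd Ld :
  baer_outside Pd Ld -> size_is_2q_sqrt_plus #|F| (dsize Pd Ld) 2.
Proof.
have [pl _] := plane_PG.
case=> [[S [T [P [[n [nq sub]] _ -> ->]]]] | [S [T [l [[n [nq sub]] _ -> ->]]]]].
all: have [cS cT] := card_subplane pl sub; rewrite /dsize -nq; apply: size_is_sqrt.
  by rewrite cS (plane_pencil pl) -nq; lia.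
by rewrite cT (plane_line pl) -nq; lia.
Qed.

Lemma large_size_neq p q s k : prime p -> 16 < q -> s = 2 * q + 1 + k ->
  ~~ below_two_thirds p q k -> ~ size_is_2q_sqrt_plus q s 2.
Proof.
move=> pr_p gt16 -> + /size_is_sqrt_inv[Q [qE sE]]; apply/negP/negPn.
have -> : k = Q.+1 by lia.
by rewrite qE; apply: below_two_thirds_sqrt; rewrite ltnNge; apply/negP; nia.
Qed.

Lemma large_sizes p q s k : prime p -> 16 < q -> s = 2 * q + 1 + k ->
  ~~ below_two_thirds p q k -> size_gt_2q_sqrt_1 q s /\ size_ge_2q_cp p q s.
Proof.
move=> pr_p gt16 sE large; have [le2 le1] := not_below_two_thirds large; split.
  by apply: size_gt_sqrt sE _; rewrite mulnn; apply: not_below_two_thirds_sqr large.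
apply: size_ge_cp pr_p _ sE _ _; first exact: leq_trans gt16.
  by move: le2; rewrite !expnS !expn0 !muln1.
by move: le1; rewrite !expnS !expn0 !muln1.
Qed.

Lemma baer_size_gt Q s : 16 < Q * Q -> s = 2 * (Q * Q) + Q + 2 -> size_gt_2q_sqrt_1 (Q * Q) s.
Proof. by move=> gt16 sE; apply: (@size_gt_sqrt _ _ Q.+1); [lia | rewrite mulnn; nia]. Qed.
End PGLemmas.

Theorem theorem4 (F : finFieldType) (p h : nat)
    (Pd : {set point F}) (Ld : {set line F}) :
  prime p -> #|F| = p ^ h -> 16 < #|F| ->
  minimal_dom Pd Ld -> primal Pd Ld ->
  let q := #|F| in
  let s := dsize Pd Ld in
  ((* (i) *)
      s = 2 * q /\
      (exists (P : point F) (l : line F),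
        [/\ inc P l, P \notin Pd, l \notin Ld,
            Pd \subset ptsof l /\ #|Pd| = q &
            Ld \subset pencil P /\ #|Ld| = q]) \/
      (* (ii) *)
      s = 2 * q + 2 /\
      (exists (P : point F) (l : line F),
        [/\ ~~ inc P l, Pd = ptsof l & Ld = pencil P]) \/
      (* (iii) *)
      size_is_2q_sqrt_plus q s 1 /\
      ((exists S T (P : point F),
          [/\ baer_subplane S T, P \in S, Ld = pencil P & Pd = S :\ P]) \/
       (exists S T (l : line F),
          [/\ baer_subplane S T, l \in T, Pd = ptsof l & Ld = T :\ l])) \/
      (* (iv) *)
      [/\ size_gt_2q_sqrt_1 q s, s < 3 * q - 1, stable_dom Pd Ld,
          ((exists (P : point F) (B : {set point F}),
              [/\ Ld = pencil P, nontrivial_blocking B, minimal_blocking B,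
                  Pd \subset B & #|B :\: Pd| <= 1]) \/
           (exists (l : line F) (B : {set line F}),
              [/\ Pd = ptsof l, nontrivial_dblocking B, minimal_dblocking B,
                  Ld \subset B & #|B :\: Ld| <= 1])) &
          ((size_is_2q_sqrt_plus q s 2 <->
              ((exists S T (P : point F),
                  [/\ baer_subplane S T, P \notin S, Ld = pencil P & Pd = S]) \/
               (exists S T (l : line F),
                  [/\ baer_subplane S T, l \notin T, Pd = ptsof l & Ld = T]))) /\
           (size_is_2q_sqrt_plus q s 2 \/ size_ge_2q_cp p q s))] \/
      (* (v) *)
      3 * q - 1 <= s)
  /\ (s < 3 * q - 1 -> stable_dom Pd Ld).
Proof.
move=> pr_p cardF gt16 minD prim q s.
have [le_s | lt_s] := leqP (3 * q - 1) s; first by split=> //; do 4!right.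
have [pl co] := plane_PG F; have [pld cod] := plane_PG_dual F.
case: prim => [[P le_q] | [l le_q]].
- have [type stab] := primal_classification pl co pr_p cardF gt16 minD le_q lt_s.
  have stable : stable_dom Pd Ld by [].
  split=> //; case: type => [l Pl eP eL | l nPl eP eL | k qE [Q [T [qQ sub _]]] nP eL sE
    | k B qE [Q [T [qQ sub _]]] nP eL sE [[blk nfull minB] sPdB cB]
    | k B large eL sE [[blk nfull minB] sPdB cB]].
  + left; have cP : #|Pd| = q.
      by have := plane_line pl l; rewrite (cardsD1 P) inE Pl add1n -eP => -[].
    have cL : #|Ld| = q.
      by have := plane_pencil pl P; rewrite (cardsD1 l) inE Pl add1n -eL => -[].
    split; first by rewrite /s /dsize cP cL mul2n addnn.
    exists P, l; rewrite {1}eP {1}eL !inE !eqxx; split=> //.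
      by rewrite eP subsetDl -eP.
    by rewrite eL subsetDl -eL.
  + right; left; split; last by exists P, l.
    by rewrite /s /dsize eP eL (plane_pencil pl) (plane_line pl) /q; lia.
  + do 2!right; left; split; first by rewrite /q qE; apply: size_is_sqrt; rewrite -qE.
    left; exists (P |: Pd), T, P; split=> //; [by exists Q | exact: setU11 | by rewrite setU1K].
  + do 3!right; left; have is2 : size_is_2q_sqrt_plus q s 2.
      by rewrite /q qE; apply: size_is_sqrt; rewrite -qE.
    split=> //; [by rewrite /q qE; apply: baer_size_gt; rewrite -qE | |].
      by left; exists P, B; split=> //; split=> // -[L]; apply/negP; exact: nfull.
    split; last by left.
    by split=> // _; left; exists Pd, T, P; split=> //; exists Q.
  + do 3!right; left; have [gt1 ge_c] := large_sizes pr_p gt16 sE large.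
    split=> //; first by left; exists P, B; split=> //; split=> // -[L]; apply/negP; exact: nfull.
    split; last by right.
    split; last exact: baer_outside_size.
    by move/(large_size_neq pr_p gt16 sE large).
(* With [q] collinear points the classification is applied to the dual plane, [Ld] and [Pd]
   exchanging roles. *)
have lt_s' : #|Ld| + #|Pd| < 3 * #|F| - 1 by rewrite addnC.
have [type stab] := primal_classification pld cod pr_p cardF gt16 (min_dom_dual minD) le_q lt_s'.
have stable : stable_dom Pd Ld by split=> // /destabilized_dual.
split=> //; case: type => [P Pl eL eP | P nPl eL eP | k qE [Q [S [qQ _ sub]]] nl eP sE
  | k B qE [Q [S [qQ _ sub]]] nl eP sE [[blk nfull minB] sLdB cB]
  | k B large eP sE [[blk nfull minB] sLdB cB]].
all: try rewrite addnC in sE.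
+ left; have cP : #|Pd| = q.
    by have := plane_line pl l; rewrite (cardsD1 P) inE Pl add1n -eP => -[].
  have cL : #|Ld| = q.
    by have := plane_pencil pl P; rewrite (cardsD1 l) inE Pl add1n -eL => -[].
  split; first by rewrite /s /dsize cP cL mul2n addnn.
  exists P, l; rewrite {1}eP {1}eL !inE !eqxx; split=> //.
    by rewrite eP subsetDl -eP.
  by rewrite eL subsetDl -eL.
+ right; left; split; last by exists P, l.
  by rewrite /s /dsize eP eL (plane_pencil pl) (plane_line pl) /q; lia.
+ do 2!right; left; split; first by rewrite /q qE; apply: size_is_sqrt; rewrite -qE.
  right; exists S, (l |: Ld), l; split=> //; [by exists Q | exact: setU11 | by rewrite setU1K].
+ do 3!right; left; have is2 : size_is_2q_sqrt_plus q s 2.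
    by rewrite /q qE; apply: size_is_sqrt; rewrite -qE.
  split=> //; [by rewrite /q qE; apply: baer_size_gt; rewrite -qE | |].
    by right; exists l, B; split=> //; split=> // -[L]; apply/negP; exact: nfull.
  split; last by left.
  by split=> // _; right; exists S, Ld, l; split=> //; exists Q.
do 3!right; left; have [gt1 ge_c] := large_sizes pr_p gt16 sE large.
split=> //; first by right; exists l, B; split=> //; split=> // -[L]; apply/negP; exact: nfull.
split; last by right.
split; last exact: baer_outside_size.
by move/(large_size_neq pr_p gt16 sE large).
Qed.
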